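(* Let $F(t)=\sum_{n\ge0}a_nt^n\in\mathbb{R}[[t]]$ with $a_0=1$, and define $R_n$ by $\sum_{n\ge0}R_nt^n=\prod_{i\ge1}F(x_it)$. (a) Every $R_n$ is $e$-positive (a nonnegative linear combination of the $e_\lambda$) if and only if $F(t)$ is the power series expansion of $e^{\gamma t}\prod_{j\ge1}(1+\alpha_jt)$ for some $\gamma\ge0$ and nonnegative reals $\alpha_j$ with $\sum_j\alpha_j$ convergent. (b) Every $R_n$ is $h$-positive (a nonnegative linear combination of the $h_\lambda$) if and only if $F(t)$ is the power series expansion of $e^{\gamma t}\prod_{j\ge1}\frac{1}{1-\beta_jt}$ for some $\gamma\ge0$ and nonnegative reals $\beta_j$ with $\sum_j\beta_j$ convergent.
   Context: $e_\lambda$ and $h_\lambda$ denote the elementary and complete homogeneous symmetric function bases. *)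

(* Defs.v *)
From HB Require Import structures.
From mathcomp Require Import all_boot all_order all_algebra.
From mathcomp Require Import all_classical all_reals all_analysis.
From mathcomp Require mpoly.

Set Implicit Arguments.
Unset Strict Implicit.
Unset Printing Implicit Defensive.

Import Order.TTheory GRing.Theory Num.Theory.
Import numFieldNormedType.Exports.
Local Open Scope ring_scope.

(* The notations of mpoly clash with those of the analysis library. *)
Import -(notations) mpoly.

(* Formal power series in t with coefficients in A, as coefficient sequences. *)
Section FormalPowerSeries.
Variable A : comNzRingType.

Definition fps_one : nat -> A := fun n => (n == 0%N)%:R.

Definition fps_mul (f g : nat -> A) : nat -> A :=
  fun n => \sum_(i < n.+1) f i * g (n - i)%N.

End FormalPowerSeries.

Section SymmetricFunctions.
Variable R : comNzRingType.

(* The ring of symmetric functions is the inverse limit, in each degree, of the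
   rings of symmetric polynomials in x_1, ..., x_N, along the maps that set the
   last variable to 0. A symmetric function f is represented by its family of
   images: f N is f(x_1, ..., x_N, 0, 0, ...). *)
Definition symfun := forall N : nat, mpoly N R.

Definition sf_e (k : nat) : symfun := fun N => mesym N R k.

Definition sf_h (k : nat) : symfun := fun N =>
  \sum_(m : bmultinom N k.+1 | mdeg (bmnm m) == k) mpolyX R (bmnm m).

Definition is_partition (la : seq nat) : bool :=
  sorted geq la && all (leq 1) la.

Definition sf_e_part (la : seq nat) : symfun := fun N =>
  \prod_(k <- la) sf_e k N.

Definition sf_h_part (la : seq nat) : symfun := fun N =>
  \prod_(k <- la) sf_h k N.

(* F(x_i t), where F has coefficient sequence a. *)
Definition fps_at_var (a : nat -> R) (N : nat) (i : 'I_N) :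
    nat -> mpoly N R :=
  fun n => a n *: mpolyX R (mnm1 i) ^+ n.

(* The coefficient of t^n in the product of the F(x_i t). In N variables it is a
   product of N factors: F(0) = a 0 is 1 in the intended use, so x_i = 0
   contributes the factor 1. *)
Definition sf_R (a : nat -> R) (n : nat) : symfun := fun N =>
  (\big[@fps_mul (mpoly N R)/@fps_one (mpoly N R)]_(i < N) fps_at_var a i) n.

End SymmetricFunctions.

Section Positivity.
Variable R : realType.

Definition nonneg_comb (b : seq nat -> symfun R) (f : symfun R) : Prop :=
  exists (s : seq (seq nat)) (c : seq nat -> R),
    [/\ uniq s,
        all is_partition s,
        (forall la, la \in s -> 0 <= c la) &
        forall N, f N = \sum_(la <- s) c la *: b la N].

Definition e_positive : symfun R -> Prop := nonneg_comb (@sf_e_part R).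

Definition h_positive : symfun R -> Prop := nonneg_comb (@sf_h_part R).

End Positivity.

Section Analysis.
Variable R : realType.
Local Open Scope classical_set_scope.

(* The limit of the partial products; it exists in the intended uses, where the
   factors are 1 + alpha_j t or 1 / (1 - beta_j t) with t near 0 and summable
   alpha, beta. *)
Definition infprod (u : nat -> R) : R :=
  limn (fun n => \prod_(0 <= j < n) u j).

(* The series with coefficients a is the power series expansion of G at 0. *)
Definition is_expansion (a : nat -> R) (G : R -> R) : Prop :=
  exists2 r : R, 0 < r &
    forall t : R, `|t| < r -> series (fun n => a n * t ^+ n) @ \oo --> G t.

End Analysis.

(* Main.v *)
(* Let B(y) be 1 + y or 1 / (1 - y), with coefficients beta, and let b_k be the
   coefficient of t^k in the product of the B(x_i t), that is e_k or h_k. Both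
   parts of the theorem are the same statement about B.

   Suppose R_n = sum_la c_la b_la with c_la >= 0. Evaluate at N variables equal to
   1/N together with v (once or twice) and let N go to infinity: the generating
   series of the b_k becomes e^t B(vt) (resp. e^t B(vt)^2) and that of the R_n becomes
   e^(pt) F(vt) (resp. e^(pt) F(vt)^2), where p = a_1. With v = 0 this makes
   n! c_la / (la! p^n) a probability on the partitions of n. With v rescaled to
   p v / n it says that the first two moments of Q(v) = prod_i B(x_i v), where
   x_i = p la_i / n, are close to f_n(v) and at most f_n(v)^2, where
   f_n(v) = sum_r a_r v^r n(n-1)...(n-r+1)/n^r; so the variance of Q(v) is O(1/n).
   Hence there are partitions la(n) whose Q converges to F at the points of a
   sequence decreasing to 0. Along an ultrafilter the x_i converge to the required
   numbers alpha_i, and the mass p - sum_i alpha_i lost at infinity is gamma.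

   Conversely, e^(gamma t) prod_j B(alpha_j t) is a coefficientwise limit of finite
   products of factors B(x t), x >= 0, for which positivity is clear, and the
   coefficients c_la stay bounded by the same probability identity. *)

From HB Require Import structures.
Require Import Defs.
From mathcomp Require Import all_boot all_order all_algebra.
From mathcomp Require Import all_classical all_reals all_analysis.
From mathcomp Require mpoly.
From mathcomp Require Import ring lra zify.

Set Implicit Arguments.
Unset Strict Implicit.
Unset Printing Implicit Defensive.

Import Order.TTheory GRing.Theory Num.Theory.
Import numFieldNormedType.Exports.
Import -(notations) mpoly.
Local Open Scope ring_scope.

Section FpsAlgebra.
Variable A : comNzRingType.
Implicit Types f g h : nat -> A.

Lemma fps_mul_trunc f g n k : (k <= n)%N ->
  fps_mul f g k = ((\poly_(i < n.+1) f i) * (\poly_(i < n.+1) g i))`_k.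
Proof.
move=> lekn; rewrite coefM; apply: eq_bigr => i _.
have lik : (i <= k)%N by rewrite -ltnS.
by rewrite !coef_poly !ltnS (leq_trans lik lekn) (leq_trans (leq_subr _ _) lekn).
Qed.

Lemma eq_fps_mul f f' g g' n :
  (forall k, (k <= n)%N -> f k = f' k) ->
  (forall k, (k <= n)%N -> g k = g' k) ->
  fps_mul f g n = fps_mul f' g' n.
Proof.
move=> ff gg; apply: eq_bigr => i _.
by rewrite ff ?gg ?leq_subr // -ltnS.
Qed.

Lemma fps_mulC : commutative (@fps_mul A).
Proof. by move=> f g; apply: funext => n; rewrite !(@fps_mul_trunc _ _ n) // mulrC. Qed.

Lemma fps_mulA : associative (@fps_mul A).
Proof.
move=> f g h; apply: funext => n.
pose T u := \poly_(i < n.+1) (u i : A).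
transitivity ((T f * (T g * T h))`_n).
  rewrite coefM; apply: eq_bigr => i _; rewrite coef_poly ltn_ord.
  by rewrite (@fps_mul_trunc _ _ n) ?leq_subr.
rewrite mulrA coefM; apply: eq_bigr => i _; rewrite coef_poly ltnS leq_subr.
by rewrite (@fps_mul_trunc _ _ n) // -ltnS.
Qed.

Lemma fps_mul1f : left_id (@fps_one A) (@fps_mul A).
Proof.
move=> f; apply: funext => n; rewrite /fps_mul big_ord_recl /= subn0.
by rewrite {1}/fps_one eqxx mul1r big1 ?addr0 // => i _; rewrite /fps_one mul0r.
Qed.

HB.instance Definition _ := Monoid.isComLaw.Build (nat -> A) (@fps_one A)
  (@fps_mul A) fps_mulA fps_mulC fps_mul1f.

Definition fps_scale (f : nat -> A) (x : A) : nat -> A := fun k => f k * x ^+ k.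

Lemma fps_scale_mul f g x :
  fps_scale (fps_mul f g) x = fps_mul (fps_scale f x) (fps_scale g x).
Proof.
apply: funext => n; rewrite /fps_scale /fps_mul big_distrl; apply: eq_bigr => i _.
by rewrite mulrACA -exprD subnKC // -ltnS.
Qed.

Definition fps_prod f (s : seq A) : nat -> A :=
  \big[@fps_mul A/@fps_one A]_(x <- s) fps_scale f x.

Lemma fps_prod_nil f : fps_prod f [::] = @fps_one A.
Proof. by rewrite /fps_prod big_nil. Qed.

Lemma fps_prod_cons f x s : fps_prod f (x :: s) = fps_mul (fps_scale f x) (fps_prod f s).
Proof. by rewrite /fps_prod big_cons. Qed.

Lemma fps_prod_cat f s1 s2 : fps_prod f (s1 ++ s2) = fps_mul (fps_prod f s1) (fps_prod f s2).
Proof. by rewrite /fps_prod big_cat. Qed.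

Lemma fps_prod_poly f s n k : (k <= n)%N ->
  fps_prod f s k = (\prod_(x <- s) \poly_(i < n.+1) fps_scale f x i)`_k.
Proof.
elim: s k => [|x s IHs] k lekn.
  by rewrite fps_prod_nil big_nil coef1.
rewrite fps_prod_cons big_cons coefM; apply: eq_bigr => i _.
have lein : (i <= n)%N by rewrite (leq_trans _ lekn) // -ltnS.
by rewrite coef_poly ltnS lein IHs // (leq_trans (leq_subr _ _)).
Qed.

End FpsAlgebra.

Lemma fps_mul_morph (A B : comNzRingType) (phi : {rmorphism A -> B}) (f g : nat -> A) n :
  phi (fps_mul f g n) = fps_mul (fun k => phi (f k)) (fun k => phi (g k)) n.
Proof. by rewrite rmorph_sum; apply: eq_bigr => i _; rewrite rmorphM. Qed.

Section SymCoefficients.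
Variable R : comNzRingType.
Implicit Types a b : nat -> R.

Lemma mcoeff_sf_R a n N (m : multinom N) :
  mcoeff m (sf_R a n N) = (mdeg m == n)%:R * \prod_(i < N) a (m i).
Proof.
have polyE : sf_R a n N
    = (\prod_(i < N) \poly_(k < n.+1) (@fps_at_var R a N i k))`_n.
  rewrite /sf_R; suff polyE r k : (k <= n)%N ->
      (\big[@fps_mul _/@fps_one _]_(i <- r) @fps_at_var R a N i) k
      = (\prod_(i <- r) \poly_(k < n.+1) (@fps_at_var R a N i k))`_k.
    exact: polyE.
  elim: r k => [|i r IHr] k lekn; first by rewrite !big_nil coef1.
  rewrite !big_cons coefM; apply: eq_bigr => j _.
  have lejn : (j <= n)%N by rewrite (leq_trans _ lekn) // -ltnS.
  by rewrite coef_poly ltnS lejn IHr // (leq_trans (leq_subr _ _)).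
rewrite {}polyE.
under eq_bigr do rewrite poly_def.
rewrite bigA_distr_bigA /= coef_sum raddf_sum /=.
pose M (f : {ffun 'I_N -> 'I_n.+1}) : multinom N :=
  Multinom [tuple (f i : nat) | i < N].
have termE (f : {ffun 'I_N -> 'I_n.+1}) :
    mcoeff m (\prod_(i < N) (@fps_at_var R a N i (f i) *: 'X^(f i)))`_n
  = (mdeg (M f) == n)%:R * (M f == m)%:R * \prod_(i < N) a (f i).
  have -> : \prod_(i < N) (@fps_at_var R a N i (f i) *: 'X^(f i))
    = ((\prod_(i < N) a (f i)) *: mpolyX R (M f)) *: 'X^(mdeg (M f)) :> {poly mpoly N R}.
    rewrite scaler_prod prodrXr mdegE; congr (_ *: 'X^_); last first.
      by apply: eq_bigr => i _; rewrite mnmE.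
    rewrite /fps_at_var scaler_prod; congr (_ *: _).
    by rewrite mpolyXE_id; apply: eq_bigr => i _; rewrite mnmE.
  rewrite coefZ coefXn eq_sym; case: (mdeg (M f) == n); last first.
    by rewrite mulr0 mcoeff0 !mul0r.
  by rewrite mulr1 mcoeffZ mcoeffX mul1r mulrC.
under eq_bigr do rewrite termE.
have [degm|degm] := eqVneq (mdeg m) n; last first.
  rewrite mul0r big1 // => f _; case: (eqVneq (M f) m) => [->|_].
    by rewrite (negPf degm) !mul0r.
  by rewrite mulr0 mul0r.
have lem i : (m i < n.+1)%N.
  by rewrite ltnS -degm mdegE (bigD1 i) //= leq_addr.
pose f0 : {ffun 'I_N -> 'I_n.+1} := [ffun i => Ordinal (lem i)].
have Mf0 : M f0 = m by apply/mnmP => i; rewrite mnmE ffunE.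
rewrite (bigD1 f0) //= [X in _ + X]big1 ?addr0; last first.
  move=> f ne; have [eqm|] := eqVneq (M f) m; last by rewrite mulr0 mul0r.
  case/eqP: ne; apply/ffunP => i; apply/val_inj; rewrite ffunE /=.
  by rewrite -eqm mnmE.
rewrite Mf0 degm !eqxx !mul1r; apply: eq_bigr => i _; by rewrite ffunE.
Qed.

Definition e_coef (k : nat) : R := (k <= 1)%:R.
Definition h_coef (k : nat) : R := 1.

Lemma sf_e_R k N : sf_e R k N = sf_R e_coef k N.
Proof.
apply/mpolyP => m; rewrite mcoeff_sf_R /sf_e mcoeff_mesym /mechar.
case: eqP => _ /=; last by rewrite mul0r.
rewrite mul1r; case: forallP => [le1|nle1].
  by rewrite big1 // => i _; rewrite /e_coef le1.
have /existsP[i ni] : [exists i, ~~ (m i <= 1)%N].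
  by rewrite -negb_forall; apply/forallP.
by rewrite (bigD1 i) //= /e_coef (negPf ni) mul0r.
Qed.

Lemma sf_h_R k N : sf_h R k N = sf_R h_coef k N.
Proof.
apply/mpolyP => m; rewrite mcoeff_sf_R /sf_h raddf_sum /= big1_eq mulr1.
have [degm|degm] := eqVneq (mdeg m) k.
  have lem : (mdeg m < k.+1)%N by rewrite degm.
  rewrite (bigD1 (BMultinom lem)) /= ?degm // mcoeffX eqxx big1 ?addr0 //.
  move=> i /andP[_ ne]; rewrite mcoeffX; case: eqP => // eqm.
  by case/eqP: ne; apply/val_inj.
rewrite big1 // => i /eqP degi; rewrite mcoeffX; case: eqP => // eqm.
by rewrite -eqm degi eqxx in degm.
Qed.

Lemma sf_R_scale a x n N : sf_R (fps_scale a x) n N = x ^+ n *: sf_R a n N.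
Proof.
apply/mpolyP => m; rewrite mcoeffZ !mcoeff_sf_R.
have [<-|_] := eqVneq (mdeg m) n; last by rewrite !mul0r mulr0.
by rewrite !mul1r big_split /= prodrXr mdegE mulrC.
Qed.

Lemma sf_R_one n N : sf_R (@fps_one R) n N = (n == 0%N)%:R.
Proof.
rewrite /sf_R big1 // => i _; apply: funext => k.
rewrite /fps_at_var /fps_one; case: k => [|k]; first by rewrite expr0 scale1r.
by rewrite scale0r.
Qed.

Lemma sf_R_mul a b n N :
  sf_R (fps_mul a b) n N = \sum_(k < n.+1) sf_R a k N * sf_R b (n - k) N.
Proof.
rewrite /sf_R (eq_bigr (fun i => fps_mul (fps_at_var a i) (fps_at_var b i))).
  by rewrite big_split.
move=> i _; apply: funext => k; rewrite /fps_at_var /fps_mul scaler_suml.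
apply: eq_bigr => j _; rewrite -scalerAl -scalerAr scalerA -exprD subnKC //.
by rewrite -ltnS.
Qed.

Lemma meval_sf_R a n (s : seq R) :
  meval (fun i : 'I_(size s) => nth 0 s i) (sf_R a n (size s)) = fps_prod a s n.
Proof.
rewrite /sf_R /fps_prod (big_nth 0) big_mkord.
move: n; apply: (big_rec2 (fun (f : nat -> mpoly (size s) R) g =>
  forall n, meval (fun i : 'I_(size s) => nth 0 s i) (f n) = g n)).
  by move=> n; rewrite /fps_one rmorph_nat.
move=> i f g _ IH n; rewrite fps_mul_morph; apply: eq_fps_mul => k _; last exact: IH.
by rewrite /fps_at_var /= mevalZ rmorphXn /= mevalXU.
Qed.

End SymCoefficients.

Local Open Scope classical_set_scope.

Section FilterLimits.
Variable R : realType.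

Lemma cvg_sum_seq (T : Type) (F : set_system T) (FF : Filter F) (I : eqType)
    (r : seq I) (f : I -> T -> R) (l : I -> R) :
  (forall i, i \in r -> f i x @[x --> F] --> l i) ->
  \sum_(i <- r) f i x @[x --> F] --> \sum_(i <- r) l i.
Proof.
elim: r => [|i r IHr] fl.
  by rewrite big_nil; under eq_cvg do rewrite big_nil; exact: cvg_cst.
rewrite big_cons; under eq_cvg do rewrite big_cons.
apply: cvgD; first by apply: fl; rewrite mem_head.
by apply: IHr => j jr; apply: fl; rewrite in_cons jr orbT.
Qed.

Lemma cvg_prod_seq (T : Type) (F : set_system T) (FF : Filter F) (I : eqType)
    (r : seq I) (f : I -> T -> R) (l : I -> R) :
  (forall i, i \in r -> f i x @[x --> F] --> l i) ->
  \prod_(i <- r) f i x @[x --> F] --> \prod_(i <- r) l i.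
Proof.
elim: r => [|i r IHr] fl.
  by rewrite big_nil; under eq_cvg do rewrite big_nil; exact: cvg_cst.
rewrite big_cons; under eq_cvg do rewrite big_cons.
apply: cvgM; first by apply: fl; rewrite mem_head.
by apply: IHr => j jr; apply: fl; rewrite in_cons jr orbT.
Qed.

Lemma ultra_bounded_cvg (U : set_system nat) (u : nat -> R) (M : R) :
  UltraFilter U -> (forall n, `|u n| <= M) -> exists l : R, u @ U --> l.
Proof.
move=> UU uM; have UP : ProperFilter U by exact: ultra_proper.
have : (u @ U) `[- M, M].
  rewrite /fmap /=; apply: (@filterS _ U _ setT) => [n _|]; last exact: filterT.
  by rewrite /= in_itv /= -ler_norml uM.
move=> /(@segment_compact R (- M) M) [l [_ lcl]]; exists l => B Bl.
have [//|UB] := in_ultra_setVsetC (u @^-1` B) UU.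
by have [x [/=]] := lcl (~` B) B UB Bl.
Qed.

Lemma tannery (F : set_system nat) (FF : ProperFilter F)
    (f : nat -> nat -> R) (M b S : nat -> R) :
  (forall n r, `|f n r| <= M r) -> cvgn (series M) ->
  (forall r, f ^~ r @ F --> b r) ->
  (forall n, series (f n) @ \oo --> S n) ->
  exists2 T : R, series b @ \oo --> T & S @ F --> T.
Proof.
move=> fM cM fb fS.
have bM r : `|b r| <= M r.
  by apply: (cvgr_to_le (cvg_norm (fb r))); near=> n; exact: fM.
have M0 r : 0 <= M r by exact: le_trans (normr_ge0 _) (fM 0%N r).
have cb : cvgn (series b).
  apply: normed_cvg; apply: (series_le_cvg _ _ bM) => // n; exact: normr_ge0.
exists (limn (series b)); first exact: cb.
have tail (g : nat -> R) (T : R) m : (forall r, `|g r| <= M r) ->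
    series g @ \oo --> T -> `|T - series g m| <= limn (series M) - series M m.
  move=> gM gT.
  have h : `|series g n - series g m| @[n --> \oo] --> `|T - series g m|.
    by apply: cvg_norm; apply: cvgB => //; exact: cvg_cst.
  apply: (cvgr_to_le h); near=> n.
  have mn : (m <= n)%N by near: n; exists m.
  rewrite sub_series_geq //; apply: (le_trans (ler_norm_sum _ _ _)).
  apply: (@le_trans _ _ (series M n - series M m)).
    by rewrite sub_series_geq //; apply: ler_sum.
  rewrite lerD2r; apply: nondecreasing_cvgn_le => //.
  by apply/nondecreasing_seqP => k; rewrite seriesSr lerDl.
apply/cvgrPdist_le => e e0.
have e3 : 0 < e / 3 by lra.
have [m mP] : exists m, limn (series M) - series M m <= e / 3.
  have /cvgrPdist_le/(_ _ e3)[m _ /(_ m (leqnn m))] := cM.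
  by move=> /ler_normlP[_ ?]; exists m.
have hm : series (f n) m @[n --> F] --> series b m.
  by apply: cvg_sum_seq => i _; exact: fb.
have /cvgrPdist_le/(_ _ e3) := hm.
apply: filterS => n hn.
have h1 := le_trans (tail _ _ m bM cb) mP.
have h2 := le_trans (tail _ _ m (fM n) (fS n)) mP.
have -> : limn (series b) - S n = (limn (series b) - series b m)
   + (series b m - series (f n) m) - (S n - series (f n) m) by ring.
apply: (le_trans (ler_normB _ _)).
have := ler_normD (limn (series b) - series b m) (series b m - series (f n) m).
lra.
Unshelve. all: by end_near. Qed.

Lemma sum_fps_mul (f g : nat -> R) n :
  \sum_(0 <= k < n) fps_mul f g k = \sum_(0 <= i < n) f i * \sum_(0 <= l < n - i) g l.
Proof.
elim: n => [|n IHn]; first by rewrite !big_nil.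
rewrite !big_nat_recr //= IHn subSnn big_nat1 /fps_mul big_ord_recr /= subnn addrA.
congr (_ + _); rewrite -(big_mkord xpredT (fun i => f i * g (n - i)%N)) -big_split /=.
rewrite !big_nat; apply: eq_bigr => i /andP[_ ltin].
by rewrite subSn 1?ltnW // big_nat_recr //= mulrDr.
Qed.

Lemma cauchy_product (f g : nat -> R) (Sf Sg : R) :
  cvgn (series (fun n => `|f n|)) -> series f @ \oo --> Sf -> series g @ \oo --> Sg ->
  series (fps_mul f g) @ \oo --> Sf * Sg.
Proof.
move=> cf fS gS.
have [M M0 gM] : exists2 M : R, 0 < M & forall n, `|series g n| <= M.
  have /cvg_seq_bounded/pinfty_ex_gt0[M M0 gM] : cvgn (series g) by apply/cvg_ex; exists Sg.
  by exists M => // n; exact: gM.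
pose h n i := if (i < n)%N then f i * series g (n - i)%N else 0.
have hS n : series (h n) @ \oo --> series (fps_mul f g) n.
  apply: cvg_near_cst; exists n => // m /= nm.
  rewrite /series /= sum_fps_mul (big_cat_nat _ nm) //= [X in _ + X]big_nat [X in _ + X]big1.
    rewrite addr0 !big_nat; apply: eq_bigr => i /andP[_ ltin].
    by rewrite /h ltin.
  by move=> i /andP[ni _]; rewrite /h ltnNge ni.
have hM n i : `|h n i| <= `|f i| * M.
  rewrite /h; case: ifP => _; last by rewrite normr0 mulr_ge0 // ltW.
  by rewrite normrM ler_wpM2l.
have cM : cvgn (series (fun i => `|f i| * M)).
  have -> : (fun i => `|f i| * M) = M *: (fun i => `|f i|).
    by apply: funext => i /=; rewrite mulrC.
  exact: is_cvg_seriesZ.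
have hf i : h n i @[n --> \oo] --> f i * Sg.
  apply: (@cvg_trans _ ((fun n => f i * series g (n - i)%N) @ \oo)).
    apply: near_eq_cvg; exists i.+1 => // n /= ltin; by rewrite /h ltin.
  by apply: cvgMl_tmp; apply: cvg_comp gS; exact: cvg_subnr.
have [T fT hT] := tannery _ hM cM hf hS.
suff -> : Sf * Sg = T by [].
apply: (cvg_unique _ _ fT) => //.
have -> : series (fun i => f i * Sg) = (fun n => series f n * Sg).
  by apply: funext => n; rewrite /series /= mulr_suml.
exact: cvgMr_tmp.
Qed.
Lemma cvg_series_half (C : R) : cvgn (series (fun r => C * 2^-1 ^+ r)).
Proof. by apply: is_cvg_geometric_series; rewrite ger0_norm ?invr_ge0 // invf_lt1 // ltr1n. Qed.

Lemma term_le_half (c : nat -> R) (C rho t : R) r :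
  (forall k, `|c k| <= C * rho ^+ k) -> 0 <= rho -> `|t| * rho <= 2^-1 ->
  `|c r * t ^+ r| <= C * 2^-1 ^+ r.
Proof.
move=> cC rho0 trho; have C0 : 0 <= C.
  by have := le_trans (normr_ge0 _) (cC 0%N); rewrite expr0 mulr1.
rewrite normrM normrX; apply: (@le_trans _ _ (C * rho ^+ r * `|t| ^+ r)).
  by rewrite ler_wpM2r // exprn_ge0.
rewrite -mulrA -exprMn; apply: ler_wpM2l => //.
by rewrite [rho * _]mulrC; apply: lerXn2r => //; rewrite nnegrE ?mulr_ge0 ?invr_ge0.
Qed.

Lemma power_series_cvg (c : nat -> R) (C rho t : R) :
  (forall k, `|c k| <= C * rho ^+ k) -> 0 <= rho -> `|t| * rho <= 2^-1 ->
  cvgn (series (fun r => c r * t ^+ r)).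
Proof.
move=> cC rho0 trho; apply: normed_cvg.
apply: (series_le_cvg _ _ (fun r => term_le_half r cC rho0 trho)) => [r|r|] //.
  exact: le_trans (normr_ge0 _) (term_le_half r cC rho0 trho).
exact: cvg_series_half.
Qed.

Lemma power_series_eq0 (d : nat -> R) (C rho : R) (v : nat -> R) :
  (forall k, `|d k| <= C * rho ^+ k) -> 0 <= rho ->
  (forall j, 0 < v j) -> (forall j, v j * rho <= 2^-1) -> v @ \oo --> 0 ->
  (forall j, series (fun r => d r * v j ^+ r) @ \oo --> 0) ->
  forall r, d r = 0.
Proof.
move=> dC rho0 v0 vrho cv dv r; elim/ltn_ind: r => m IHm.
pose f j r := d (m + r)%N * v j ^+ r.
have shiftC k : `|d (m + k)%N| <= C * rho ^+ m * rho ^+ k.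
  by rewrite -mulrA -exprD.
have fM j k : `|f j k| <= C * rho ^+ m * 2^-1 ^+ k.
  by apply: (term_le_half k shiftC) => //; rewrite gtr0_norm.
have fb k : f ^~ k @ \oo --> d m * (k == 0%N)%:R.
  rewrite /f; case: k => [|k].
    by apply: cvg_near_cst; exists 0%N => // n _; rewrite addn0 expr0.
  rewrite mulr0 -[X in _ --> X](mulr0 (d (m + k.+1)%N)); apply: cvgMl_tmp.
  rewrite -[X in _ --> X](expr0n R k.+1).
  exact: (cvg_comp _ _ cv (@exprn_continuous R k.+1 0)).
have fS j : series (f j) @ \oo --> (fun=> 0 : R) j.
  have -> : series (f j) = (fun n => (v j ^+ m)^-1 * series (fun r => d r * v j ^+ r) (n + m)%N).
    apply: funext => n; rewrite /series /= (big_cat_nat _ (leq_addl n m)) //=.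
    rewrite [X in _ * (X + _)]big_nat [X in _ * (X + _)]big1; last first.
      by move=> i /andP[_ /IHm ->]; rewrite mul0r.
    rewrite add0r -{2}[m]add0n big_addn addnK mulr_sumr; apply: eq_bigr => i _.
    by rewrite /f exprD [(m + i)%N]addnC; field; rewrite expf_neq0 // gt_eqF.
  rewrite -[X in _ --> X](mulr0 (v j ^+ m)^-1); apply: cvgMl_tmp.
  by rewrite (cvg_shiftn m).
have [T bT] := tannery _ fM (@cvg_series_half _) fb fS.
move=> /(cvg_unique _ (cvg_cst (0 : R))) T0.
rewrite -T0 // in bT; apply: (cvg_unique _ _ bT) => //.
apply: cvg_near_cst; exists 1%N => // -[//|n] _.
by rewrite /series /= big_nat_recl //= mulr1 big1 ?addr0 // => i _; rewrite mulr0.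
Qed.

End FilterLimits.

Section FallingFactorialRatio.
Variable R : realType.

Definition ffr (n r : nat) : R := (n ^_ r)%:R / n%:R ^+ r.

Lemma ffr0 n : ffr n 0 = 1.
Proof. by rewrite /ffr ffactn0 expr0 divr1. Qed.

Lemma ffr_ge0 n r : 0 <= ffr n r.
Proof. by rewrite divr_ge0 ?ler0n ?exprn_ge0. Qed.

Lemma ffrS n r : (0 < n)%N -> ffr n r.+1 = ffr n r * (1 - r%:R / n%:R).
Proof.
move=> n0; have n0' : n%:R != 0 :> R by rewrite pnatr_eq0 -lt0n.
rewrite /ffr ffactnSr natrM exprSr; have [lern|ltnr] := leqP r n.
  by rewrite natrB //; field; rewrite ?expf_neq0 // n0'.
by rewrite ffact_small // !mul0r.
Qed.

Lemma ffr_le1 n r : (0 < n)%N -> ffr n r <= 1.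
Proof.
move=> n0; elim: r => [|r IHr]; first by rewrite ffr0.
rewrite ffrS //; apply: le_trans IHr.
by rewrite ler_piMr ?ffr_ge0 // lerBlDr lerDl divr_ge0.
Qed.

Lemma ffr_ge n r : (0 < n)%N -> 1 - ffr n r <= (r * r.-1)%:R / n%:R.
Proof.
move=> n0; have n0' : 0 < n%:R :> R by rewrite ltr0n.
elim: r => [|r IHr]; first by rewrite ffr0 mul0n mul0r subrr.
rewrite ffrS //=; have := ffr_le1 r n0; have := ffr_ge0 n r => r0 r1.
have q0 : 0 <= r%:R / n%:R :> R by rewrite divr_ge0.
have -> : (r.+1 * r)%:R / n%:R = (r * r.-1)%:R / n%:R + 2 * (r%:R / n%:R) :> R.
  have -> : (r.+1 * r = r * r.-1 + 2 * r)%N by case: r {IHr r0 r1 q0} => //= r; lia.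
  by rewrite natrD mulrDl (natrM _ 2) -[2 * _ * _]mulrA.
by nra.
Qed.

Lemma ffactnD_le n r s : (n ^_ (r + s) <= n ^_ r * n ^_ s)%N.
Proof.
elim: s => [|s IHs]; first by rewrite addn0 ffactn0 muln1.
by rewrite addnS !ffactnSr mulnA leq_mul // leq_sub2l // leq_addl.
Qed.

Lemma ffrD_le n r s : ffr n (r + s) <= ffr n r * ffr n s.
Proof.
rewrite /ffr mulrACA -invfM -exprD; apply: ler_wpM2r.
  by rewrite invr_ge0 exprn_ge0.
by rewrite -natrM ler_nat ffactnD_le.
Qed.

Lemma cvg_natV : (n%:R : R)^-1 @[n --> \oo] --> (0 : R).
Proof.
by rewrite -(cvg_shiftS (fun n : nat => (n%:R : R)^-1)); exact: cvg_harmonic.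
Qed.

Lemma cvg_ffr r : ffr n r @[n --> \oo] --> (1 : R).
Proof.
have h1 : 1 - (r * r.-1)%:R / n%:R @[n --> \oo] --> (1 : R).
  rewrite -[X in _ --> X]subr0 -[X in _ --> _ - X](mulr0 (r * r.-1)%:R).
  by apply: cvgB; [exact: cvg_cst|apply: cvgMl_tmp; exact: cvg_natV].
apply: (squeeze_cvgr _ h1); last exact: cvg_cst.
near=> n; have n0 : (0 < n)%N by near: n; exists 1%N.
by rewrite lerBlDr -lerBlDl ffr_ge // ffr_le1.
Unshelve. all: by end_near. Qed.

End FallingFactorialRatio.

Section ExponentialSpecialization.
Variable R : realType.
Implicit Types (a f g : nat -> R) (s : seq R).

Definition expc (q : R) (k : nat) : R := q ^+ k / k`!%:R.

Lemma fps_mul_expc q f z n :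
  fps_mul (expc q) (fps_scale f z) n
  = n`!%:R^-1 * \sum_(0 <= r < n.+1) f r * z ^+ r * q ^+ (n - r) * (n ^_ r)%:R.
Proof.
rewrite fps_mulC /fps_mul big_mkord mulr_sumr; apply: eq_bigr => i _.
have lein : (i <= n)%N by rewrite -ltnS.
rewrite /fps_scale /expc -(ffact_fact lein) natrM; field.
by rewrite !pnatr_eq0 -!lt0n fact_gt0 ffact_gt0.
Qed.

Lemma fps_prod_nseq_scale a (x : R) N : fps_prod a (nseq N x) = fps_scale (fps_prod a (nseq N 1)) x.
Proof.
elim: N => [|N IHN].
  rewrite !fps_prod_nil; apply: funext => k; rewrite /fps_scale /fps_one.
  by case: k => [|k]; rewrite ?mul1r ?mul0r.
rewrite !fps_prod_cons fps_scale_mul -IHN; congr fps_mul; apply: funext => k.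
by rewrite /fps_scale expr1n mulr1.
Qed.

Lemma fps_prod_nseq_cvg a (u : R) k : a 0%N = 1 ->
  fps_prod a (nseq N (u / N%:R)) k @[N --> \oo] --> expc (a 1%N * u) k.
Proof.
move=> a0; pose Q := \poly_(i < k) a i.+1.
have polyE : \poly_(i < k.+1) fps_scale a 1 i = 1 + 'X * Q.
  apply/polyP => i; rewrite coefD coef1 coefXM !coef_poly /fps_scale expr1n mulr1.
  by case: i => [|i] /=; rewrite ?a0 ?addr0 ?add0r.
pose q i := (Q ^+ i)`_(k - i).
have coefE N : (k <= N)%N -> fps_prod a (nseq N 1) k
    = \sum_(0 <= i < k.+1) 'C(N, i)%:R * q i.
  move=> leKN; rewrite (@fps_prod_poly _ _ _ k) // big_nseq iter_mulr_1 polyE.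
  rewrite exprDn.
  rewrite coef_sum -(big_mkord xpredT (fun i => ((1 ^+ (N - i) * ('X * Q) ^+ i) *+ 'C(N, i))`_k)).
  rewrite (big_cat_nat _ (_ : (k.+1 <= N.+1)%N)) //= [X in _ + X]big_nat [X in _ + X]big1.
    rewrite addr0 !big_nat; apply: eq_bigr => i /andP[_]; rewrite ltnS => leik.
    by rewrite expr1n mul1r coefMn exprMn coefXnM ltnNge leik /= mulr_natl.
  move=> i /andP[ltki _].
  by rewrite expr1n mul1r coefMn exprMn coefXnM ltki mul0rn.
have cvgC i : (i <= k)%N ->
    'C(N, i)%:R / N%:R ^+ k @[N --> \oo] --> ((i == k)%:R / k`!%:R : R).
  move=> leik.
  have h : ffr R N i / i`!%:R * (N%:R ^-1) ^+ (k - i) @[N --> \oo]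
      --> (1 / i`!%:R * 0 ^+ (k - i) : R).
    apply: cvgM; first by apply: cvgMr_tmp; exact: cvg_ffr.
    exact: (cvg_comp _ _ (@cvg_natV R) (@exprn_continuous R _ 0)).
  have -> : (i == k)%:R / k`!%:R = 1 / i`!%:R * 0 ^+ (k - i) :> R.
    rewrite expr0n subn_eq0; have [->|ne] := eqVneq i k.
      by rewrite leqnn mulr1.
    by rewrite leqNgt ltn_neqAle ne leik mulr0 mul0r.
  apply: cvg_trans h; apply: near_eq_cvg; near=> N.
  have N0 : N%:R != 0 :> R by rewrite pnatr_eq0 -lt0n; near: N; exists 1%N.
  rewrite /ffr -bin_ffact natrM -{2}(subnKC leik) exprD exprVn; field.
  by rewrite !expf_neq0 // pnatr_eq0 -lt0n fact_gt0.
have h : \sum_(0 <= i < k.+1) 'C(N, i)%:R / N%:R ^+ k * (u ^+ k * q i) @[N --> \oo]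
    --> \sum_(0 <= i < k.+1) (i == k)%:R / k`!%:R * (u ^+ k * q i).
  apply: cvg_sum_seq => i; rewrite mem_index_iota ltnS => /andP[_ leik].
  by apply: cvgMr_tmp; exact: cvgC.
have -> : expc (a 1%N * u) k = \sum_(0 <= i < k.+1) (i == k)%:R / k`!%:R * (u ^+ k * q i).
  rewrite big_nat_recr //= big_nat big1 ?add0r => [|i /andP[_ ltik]]; last first.
    by rewrite (ltn_eqF ltik) !mul0r.
  rewrite eqxx /q subnn -horner_coef0 horner_exp horner_coef0 coef_poly.
  by rewrite /expc exprMn; case: (k) => [|k'] /=; rewrite ?expr0; ring.
apply: cvg_trans h; apply: near_eq_cvg; near=> N.
have leKN : (k <= N)%N by near: N; exists k.
rewrite fps_prod_nseq_scale {1}/fps_scale coefE // mulr_suml; apply: eq_bigr => i _.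
by rewrite expr_div_n; ring.
Unshelve. all: by end_near. Qed.

Lemma fps_mulE f g k : fps_mul f g k = \sum_(0 <= i < k.+1) f i * g (k - i)%N.
Proof. by rewrite big_mkord. Qed.

Lemma expc_specialization a f n (L : seq (seq nat)) (c : seq nat -> R) :
  a 0%N = 1 -> f 0%N = 1 ->
  (forall s, fps_prod a s n = \sum_(la <- L) c la * \prod_(k <- la) fps_prod f s k) ->
  forall u s, fps_mul (expc (a 1%N * u)) (fps_prod a s) n
    = \sum_(la <- L) c la * \prod_(k <- la) fps_mul (expc (f 1%N * u)) (fps_prod f s) k.
Proof.
move=> a0 f0 H u s.
have lim g k : g 0%N = 1 -> fps_prod g (nseq N (u / N%:R) ++ s) k @[N --> \oo]
    --> fps_mul (expc (g 1%N * u)) (fps_prod g s) k.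
  move=> g0; under eq_cvg do rewrite fps_prod_cat fps_mulE.
  rewrite fps_mulE.
  by apply: cvg_sum_seq => i _; apply: cvgMr_tmp; exact: fps_prod_nseq_cvg.
apply: (cvg_unique _ (lim _ n a0)) => //=.
under eq_cvg do rewrite H.
apply: cvg_sum_seq => la _; apply: cvgMl_tmp.
by apply: cvg_prod_seq => k _; exact: lim.
Qed.
End ExponentialSpecialization.

Lemma big_nth_drop (R : realType) (T : Type) (idx : T) (op : Monoid.law idx)
    (f : R -> T) (s : seq R) (J : nat) : f 0 = idx ->
  \big[op/idx]_(x <- s) f x
  = op (\big[op/idx]_(0 <= i < J) f (nth 0 s i)) (\big[op/idx]_(x <- drop J s) f x).
Proof.
move=> f0; elim: J s => [|J IHJ] s.
  by rewrite [X in op X]big_nil Monoid.mul1m drop0.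
rewrite big_nat_recl // -Monoid.mulmA; case: s => [|x s] /=; last by rewrite big_cons (IHJ s).
by rewrite f0 Monoid.mul1m big_nil Monoid.mulm1 big1.
Qed.

Lemma sorted_drop_le (R : realType) (s : seq R) (J : nat) (y : R) :
  sorted >=%R s -> all (fun x => 0 <= x) s -> y \in drop J s ->
  J%:R * y <= \sum_(x <- s) x.
Proof.
move=> sS s0 yd; have szJ : (J <= size s)%N.
  by case: leqP => // /ltnW ltJ; rewrite drop_oversize in yd.
rewrite -{1}(cat_take_drop J s) big_cat /=.
have /allrelP rel : allrel >=%R (take J s) (drop J s).
  move: sS; rewrite sorted_pairwise; last by move=> a b c ab bc; exact: le_trans bc ab.
  by rewrite -{1}(cat_take_drop J s) pairwise_cat => /andP[].
rewrite -[leLHS]addr0; apply: lerD.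
  apply: (@le_trans _ _ (\sum_(x <- take J s) y)).
    by rewrite big_const_seq count_predT size_takel // iter_addr_0 mulr_natl.
  by rewrite !big_seq; apply: ler_sum => x xt; exact: rel.
rewrite big_seq; apply: sumr_ge0 => x xd; move/allP: s0; apply; exact: mem_drop xd.
Qed.

Lemma cvg_expR_comp (R : realType) (T : Type) (F : set_system T) (FF : Filter F)
    (f : T -> R) (l : R) :
  f @ F --> l -> expR (f x) @[x --> F] --> expR l.
Proof. by move=> fl; exact: (cvg_comp _ _ fl (@continuous_expR R l)). Qed.

(* The factors 1 + y and 1 / (1 - y) are treated uniformly: the argument only
   uses the following properties of the factor B and of its coefficients. *)
Record factor_series (R : realType) (beta : nat -> R) (B : R -> R) : Prop :=
  FactorSeries {
    factor_coef0 : beta 0%N = 1;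
    factor_coef1 : beta 1%N = 1;
    factor_coef01 : forall k, 0 <= beta k <= 1;
    factor_cvg : forall y : R, `|y| <= 2^-1 ->
      series (fun k => beta k * y ^+ k) @ \oo --> B y;
    factor_bound : forall y : R, `|y| <= 2^-1 ->
      expR (y - 2 * y ^+ 2) <= B y <= expR (y + 2 * y ^+ 2);
    factor_continuous : forall y : R, `|y| <= 2^-1 -> B z @[z --> y] --> B y
  }.

Section ProductSeries.
Variables (R : realType) (beta : nat -> R) (B : R -> R).
Hypothesis BH : factor_series beta B.
Let beta01 := factor_coef01 BH.
Let B_series := factor_cvg BH.
Let B_bound := factor_bound BH.
Let B_cont := factor_continuous BH.

Implicit Types (s : seq R) (t : R).

Definition qprod s t : R := \prod_(x <- s) B (x * t).

Lemma B_at0 : B 0 = 1.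
Proof.
have := @B_bound 0; rewrite normr0 expr0n mulr0 subr0 addr0 expR0 => h.
by apply/eqP; rewrite eq_le andbC h // invr_ge0.
Qed.

Lemma B_gt0 y : `|y| <= 2^-1 -> 0 < B y.
Proof. by move=> /B_bound/andP[+ _]; apply: lt_le_trans; exact: expR_gt0. Qed.

Lemma fps_prod_ge0 s r : all (fun x => 0 <= x) s -> 0 <= fps_prod beta s r.
Proof.
elim: s r => [|x s IHs] r /=; first by rewrite fps_prod_nil ler0n.
move=> /andP[x0 s0]; rewrite fps_prod_cons; apply: sumr_ge0 => i _.
by rewrite mulr_ge0 ?IHs // mulr_ge0 ?exprn_ge0 //; case/andP: (beta01 i).
Qed.

Lemma fps_prod_le s r : all (fun x => 0 <= x) s ->
  fps_prod beta s r <= (\sum_(x <- s) x) ^+ r.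
Proof.
elim: s r => [|x s IHs] r /=.
  by rewrite fps_prod_nil big_nil expr0n.
move=> /andP[x0 s0]; rewrite fps_prod_cons big_cons addrC exprDn.
apply: ler_sum => i _; have /andP[b0 b1] := beta01 i.
have xi0 : 0 <= x ^+ i by rewrite exprn_ge0.
have S0 : 0 <= (\sum_(x <- s) x) ^+ (r - i).
  by rewrite exprn_ge0 // big_seq sumr_ge0 // => y; move/allP: s0; apply.
apply: (@le_trans _ _ ((\sum_(x <- s) x) ^+ (r - i) * x ^+ i)).
  rewrite /fps_scale mulrC; apply: ler_pM => //; first exact: fps_prod_ge0.
  - by rewrite mulr_ge0.
  - exact: IHs.
  by rewrite ler_piMl.
rewrite -mulr_natr ler_peMr ?mulr_ge0 // ler1n bin_gt0 -ltnS; exact: ltn_ord.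
Qed.

Lemma factor_norm_cvg (y : R) : `|y| <= 2^-1 ->
  cvgn (series (fun k => `|beta k * y ^+ k|)).
Proof.
move=> y2; have hb k : `|beta k| <= 1 * 1 ^+ k.
  by rewrite expr1n mulr1 ger0_norm; case/andP: (beta01 k).
have := fun k => @term_le_half R beta 1 1 y k hb ler01; rewrite mulr1 => hk.
apply: (series_le_cvg _ _ (fun k => hk k y2)) => [//|k|].
  by rewrite mul1r exprn_ge0 // invr_ge0.
exact: cvg_series_half.
Qed.

Lemma fps_prod_cvg s t : (forall x, x \in s -> `|x * t| <= 2^-1) ->
  series (fun r => fps_prod beta s r * t ^+ r) @ \oo --> qprod s t.
Proof.
elim: s => [|x s IHs] st.
  rewrite /qprod big_nil; apply: cvg_near_cst; exists 1%N => // -[//|n] _.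
  rewrite /series /= big_nat_recl //= fps_prod_nil mul1r expr0 big1 ?addr0 // => i _.
  by rewrite mul0r.
have xt : `|x * t| <= 2^-1 by apply: st; rewrite mem_head.
have -> : (fun r => fps_prod beta (x :: s) r * t ^+ r)
    = fps_mul (fun k => beta k * (x * t) ^+ k) (fun r => fps_prod beta s r * t ^+ r).
  rewrite fps_prod_cons -/(fps_scale _ t) fps_scale_mul; congr fps_mul.
  by apply: funext => k; rewrite /fps_scale exprMn mulrA.
rewrite /qprod big_cons; apply: cauchy_product; last 2 first.
- exact: B_series.
- by apply: IHs => y ys; apply: st; rewrite in_cons ys orbT.
exact: factor_norm_cvg.
Qed.

Lemma qprod_bound s t : (forall x, x \in s -> `|x * t| <= 2^-1) ->
  expR (t * (\sum_(x <- s) x) - 2 * t ^+ 2 * \sum_(x <- s) x ^+ 2) <= qprod s t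
  <= expR (t * (\sum_(x <- s) x) + 2 * t ^+ 2 * \sum_(x <- s) x ^+ 2).
Proof.
elim: s => [|x s IHs] st.
  by rewrite /qprod !big_nil !mulr0 subr0 addr0 expR0 lexx.
have /andP[l1 u1] := B_bound (st x (mem_head _ _)).
have sts y : y \in s -> `|y * t| <= 2^-1 by move=> ys; apply: st; rewrite in_cons ys orbT.
have /andP[l2 u2] := IHs sts.
rewrite /qprod !big_cons -/(qprod s t).
set S := \sum_(x <- s) x in l2 u2 *; set S2 := \sum_(x <- s) x ^+ 2 in l2 u2 *.
apply/andP; split.
  have -> : t * (x + S) - 2 * t ^+ 2 * (x ^+ 2 + S2)
    = (x * t - 2 * (x * t) ^+ 2) + (t * S - 2 * t ^+ 2 * S2) by ring.
  by rewrite expRD ler_pM ?expR_ge0.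
have -> : t * (x + S) + 2 * t ^+ 2 * (x ^+ 2 + S2)
    = (x * t + 2 * (x * t) ^+ 2) + (t * S + 2 * t ^+ 2 * S2) by ring.
by rewrite expRD ler_pM // ltW // ?(lt_le_trans (expR_gt0 _) l1) // (lt_le_trans (expR_gt0 _) l2).
Qed.

Lemma ultra_coef (U : set_system nat) (s : nat -> seq R) (sigma : R) :
  UltraFilter U -> (forall n, all (fun x => 0 <= x) (s n)) ->
  (forall n, \sum_(x <- s n) x <= sigma) ->
  exists q : nat -> R,
    [/\ forall r, fps_prod beta (s n) r @[n --> U] --> q r,
        forall r, `|q r| <= sigma ^+ r &
        forall (t L : R), `|t| * sigma <= 2^-1 -> qprod (s n) t @[n --> U] --> L ->
          series (fun r => q r * t ^+ r) @ \oo --> L].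
Proof.
move=> UU s0 sS; have UP : ProperFilter U by exact: ultra_proper.
have bound n r : `|fps_prod beta (s n) r| <= sigma ^+ r.
  rewrite ger0_norm ?fps_prod_ge0 //; apply: (le_trans (fps_prod_le r (s0 n))).
  have S0 : 0 <= \sum_(x <- s n) x.
    by rewrite big_seq sumr_ge0 // => y; move/allP: (s0 n); apply.
  by apply: lerXn2r; rewrite ?nnegrE // (le_trans S0 (sS n)).
have /choice[q qP] : forall r, exists l : R, fps_prod beta (s n) r @[n --> U] --> l.
  by move=> r; apply: (ultra_bounded_cvg UU (fun n => bound n r)).
have sigma0 : 0 <= sigma.
  by apply: le_trans (sS 0%N); rewrite big_seq sumr_ge0 // => y; move/allP: (s0 0%N); apply.
exists q; split => // [r|t L ts qL].
  by apply: (cvgr_to_le (cvg_norm (qP r))); near=> n; exact: bound.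
have bound1 n r : `|fps_prod beta (s n) r| <= 1 * sigma ^+ r by rewrite mul1r.
have fS n : series (fun r => fps_prod beta (s n) r * t ^+ r) @ \oo --> qprod (s n) t.
  apply: fps_prod_cvg => x xs; have x0 : 0 <= x by move/allP: (s0 n); apply.
  rewrite normrM mulrC (ger0_norm x0); apply: le_trans ts; apply: ler_wpM2l => //.
  apply: le_trans (sS n); rewrite big_seq (big_rem x) //= xs lerDl.
  rewrite big_seq_cond sumr_ge0 // => y /andP[/mem_rem ys _].
  by move/allP: (s0 n); apply.
have [T qT] := tannery _ (fun n r => term_le_half r (bound1 n) sigma0 ts)
   (@cvg_series_half _ _) (fun r => @cvgMr_tmp _ _ _ _ _ _ _ (qP r)) fS.
by move=> /(cvg_unique _ qL) ->.
Unshelve. all: by end_near. Qed.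

Lemma ultra_product (U : set_system nat) (s : nat -> seq R) (sigma : R) :
  UltraFilter U -> (forall n, sorted >=%R (s n)) ->
  (forall n, all (fun x => 0 <= x) (s n)) ->
  (forall n, \sum_(x <- s n) x = sigma) ->
  exists (gamma : R) (alpha : nat -> R),
    [/\ 0 <= gamma, forall j, 0 <= alpha j, cvgn (series alpha) &
        forall t, `|t| * sigma <= 2^-1 ->
          qprod (s n) t @[n --> U] --> expR (gamma * t) * infprod (fun j => B (alpha j * t))].
Proof.
move=> UU sS s0 sigmaE; have UP : ProperFilter U by exact: ultra_proper.
have sigma0 : 0 <= sigma.
  by rewrite -(sigmaE 0%N) big_seq sumr_ge0 // => y; move/allP: (s0 0%N); apply.
have drop_ge0 n J x : x \in drop J (s n) -> 0 <= x.
  by move=> /mem_drop; move/allP: (s0 n); apply.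
pose x n i : R := nth 0 (s n) i.
have x0 n i : 0 <= x n i.
  rewrite /x; have [ltis|leis] := ltnP i (size (s n)); last by rewrite nth_default.
  by move/allP: (s0 n); apply; rewrite mem_nth.
pose tau n J : R := \sum_(y <- drop J (s n)) y.
have tau0 n J : 0 <= tau n J by rewrite /tau big_seq sumr_ge0 // => y /drop_ge0.
have splitE n J : sigma = \sum_(0 <= i < J) x n i + tau n J.
  by rewrite -(sigmaE n) (@big_nth_drop _ _ _ _ id _ J).
have psum_le n J : \sum_(0 <= i < J) x n i <= sigma by rewrite (splitE n J) lerDl.
have mem_le n J y : y \in drop J (s n) -> y <= sigma.
  move=> yd; rewrite (splitE n J) /tau (big_rem y) //= addrCA lerDl.
  rewrite addr_ge0 //; first exact: sumr_ge0.
  by rewrite big_seq sumr_ge0 // => z /mem_rem /drop_ge0.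
have x_le n i : x n i <= sigma.
  by apply: le_trans (psum_le n i.+1); rewrite big_nat_recr //= lerDr sumr_ge0.
have /choice[alpha alphaP] : forall i, exists l : R, x n i @[n --> U] --> l.
  move=> i; apply: (@ultra_bounded_cvg _ _ _ sigma) => // n.
  by rewrite ger0_norm.
have alpha0 j : 0 <= alpha j by apply: (cvgr_to_ge (alphaP j)); near=> n.
have psumP J : \sum_(0 <= i < J) x n i @[n --> U] --> series alpha J.
  by apply: cvg_sum_seq => i _; exact: alphaP.
have alpha_le J : series alpha J <= sigma.
  by apply: (cvgr_to_le (psumP J)); near=> n.
have alpha_nd : nondecreasing_seq (series alpha).
  by apply/nondecreasing_seqP => k; rewrite seriesSr lerDl.
have alpha_cvg : cvgn (series alpha).
  by apply: nondecreasing_is_cvgn => //; exists sigma => _ [J _ <-].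
exists (sigma - limn (series alpha)), alpha; split => //.
  by rewrite subr_ge0; apply: limr_le => //; near=> J.
move=> t ts.
have small (y : R) : 0 <= y -> y <= sigma -> `|y * t| <= 2^-1.
  move=> y0 ys; rewrite normrM mulrC (ger0_norm y0); apply: le_trans ts.
  exact: ler_wpM2l.
have alpha_small j : `|alpha j * t| <= 2^-1.
  by apply: small => //; apply: (cvgr_to_le (alphaP j)); near=> n.
pose P J := \prod_(0 <= j < J) B (alpha j * t).
have PP J : \prod_(0 <= i < J) B (x n i * t) @[n --> U] --> P J.
  apply: cvg_prod_seq => i _.
  apply: (cvg_comp _ _ _ (B_cont (alpha_small i))).
  by apply: cvgMr_tmp; exact: alphaP.
pose eps J : R := 2 * t ^+ 2 * (sigma ^+ 2 / J%:R).
have sq_le n J : (0 < J)%N -> \sum_(y <- drop J (s n)) y ^+ 2 <= sigma ^+ 2 / J%:R.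
  move=> J0; have J0' : 0 < J%:R :> R by rewrite ltr0n.
  apply: (@le_trans _ _ (sigma / J%:R * tau n J)).
    rewrite /tau mulr_sumr !big_seq; apply: ler_sum => y yd.
    rewrite expr2; apply: ler_wpM2r; first exact: drop_ge0 yd.
    by rewrite ler_pdivlMr // mulrC -(sigmaE n); exact: sorted_drop_le.
  rewrite expr2 -!mulrA; apply: ler_wpM2l => //; rewrite mulrC.
  by apply: ler_wpM2r; rewrite ?invr_ge0 // (splitE n J) lerDr sumr_ge0.
have factor n J : (0 < J)%N ->
    expR (t * tau n J - eps J) <= qprod (drop J (s n)) t <= expR (t * tau n J + eps J).
  move=> J0; have /andP[l u] := @qprod_bound (drop J (s n)) t
    (fun y yd => small y (drop_ge0 _ _ _ yd) (mem_le _ _ _ yd)).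
  have e := ler_wpM2l (_ : 0 <= 2 * t ^+ 2) (sq_le n J J0).
  have {}e := e (mulr_ge0 (ler0n _ 2) (sqr_ge0 t)).
  apply/andP; split; [apply: le_trans l|apply: (le_trans u)];
    rewrite ler_expR -/(tau n J) /eps; lra.
have Q_split n J : qprod (s n) t
    = \prod_(0 <= i < J) B (x n i * t) * qprod (drop J (s n)) t.
  by rewrite /qprod (@big_nth_drop _ _ _ _ (fun y => B (y * t)) _ J) // mul0r B_at0.
have B0 n i : 0 <= B (x n i * t) by rewrite ltW // B_gt0 // small.
have [L LP] : exists L : R, qprod (s n) t @[n --> U] --> L.
  apply: (@ultra_bounded_cvg _ _ _ (expR (t * sigma + 2 * t ^+ 2 * sigma ^+ 2))) => // n.
  have mem0 y : y \in s n -> 0 <= y <= sigma.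
    by rewrite -{1}(drop0 (s n)) => yd; rewrite (drop_ge0 n 0%N) ?(mem_le n 0%N).
  have /andP[l u] := @qprod_bound (s n) t
    (fun y ys => small y (proj1 (andP (mem0 y ys))) (proj2 (andP (mem0 y ys)))).
  rewrite ger0_norm ?(le_trans (expR_ge0 _) l) //; apply: (le_trans u).
  rewrite ler_expR sigmaE lerD2l; apply: ler_wpM2l; first by rewrite mulr_ge0 ?sqr_ge0.
  rewrite expr2 -{2}(sigmaE n) mulr_sumr !big_seq; apply: ler_sum => y /mem0/andP[y0 ys].
  by rewrite expr2; apply: ler_wpM2r.
have PB J : (0 < J)%N ->
  L * expR (- (t * (sigma - series alpha J)) - eps J) <= P J
    <= L * expR (- (t * (sigma - series alpha J)) + eps J).
  move=> J0.
  have hexp e : \prod_(0 <= i < J) B (x n i * t) * expR (t * tau n J + e) @[n --> U]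
      --> P J * expR (t * (sigma - series alpha J) + e).
    apply: cvgM => //; apply: cvg_expR_comp.
    apply: cvgD; last exact: cvg_cst.
    apply: cvgMl_tmp; have -> : tau ^~ J = (fun n => sigma - \sum_(0 <= i < J) x n i).
      by apply: funext => n; rewrite {1}(splitE n J); ring.
    by apply: cvgB => //; exact: cvg_cst.
  have l1 : P J * expR (t * (sigma - series alpha J) - eps J) <= L.
    apply: (ler_cvg_to (hexp (- eps J)) LP); near=> n; rewrite (Q_split n J).
    by apply: ler_wpM2l; [exact: prodr_ge0|case/andP: (factor n J J0)].
  have l2 : L <= P J * expR (t * (sigma - series alpha J) + eps J).
    apply: (ler_cvg_to LP (hexp (eps J))); near=> n; rewrite (Q_split n J).
    by apply: ler_wpM2l; [exact: prodr_ge0|case/andP: (factor n J J0)].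
  set T := t * _ in l1 l2 *; apply/andP; split.
    rewrite -ler_pdivlMr ?expR_gt0 // -expRN; apply: (le_trans l2).
    by rewrite opprB opprK addrC.
  rewrite -ler_pdivrMr ?expR_gt0 // -expRN; apply: le_trans l1.
  by rewrite opprD opprK.
have Pcvg : P @ \oo --> L * expR (- (t * (sigma - limn (series alpha)))).
  have h (e : R) : L * expR (- (t * (sigma - series alpha J))
        + e * (2 * t ^+ 2 * (sigma ^+ 2 / J%:R))) @[J --> \oo]
      --> L * expR (- (t * (sigma - limn (series alpha)))).
    apply: cvgMl_tmp; apply: cvg_expR_comp.
    rewrite -[X in _ --> X]addr0; apply: cvgD.
      by apply: cvgN; apply: cvgMl_tmp; apply: cvgB => //; exact: cvg_cst.
    rewrite -[X in _ --> X](mulr0 (e * (2 * t ^+ 2 * sigma ^+ 2))).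
    under eq_cvg do rewrite !mulrA.
    by rewrite !mulrA; apply: cvgMl_tmp; exact: cvg_natV.
  apply: (squeeze_cvgr _ (h (- 1)) (h 1)); near=> J.
  by rewrite mulN1r mul1r; apply: PB; near: J; exists 1%N.
rewrite /infprod (cvg_lim _ Pcvg) // mulrCA -expRD.
suff -> : (sigma - limn (series alpha)) * t + - (t * (sigma - limn (series alpha))) = 0.
  by rewrite expR0 mulr1.
by ring.
Unshelve. all: by end_near. Qed.

End ProductSeries.

Lemma leq_prod_fact (la : seq nat) : (\prod_(k <- la) k`! <= (sumn la)`!)%N.
Proof.
elim: la => [|k la IH]; first by rewrite big_nil.
rewrite big_cons /=; apply: (@leq_trans (k`! * (sumn la)`!)); first by rewrite leq_mul2l IH orbT.
have /bin_fact := leq_addr (sumn la) k; rewrite addKn => <-.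
by rewrite leq_pmull // bin_gt0 leq_addr.
Qed.

Section PositiveExpansion.
Variables (R : realType) (beta : nat -> R) (B : R -> R).
Hypothesis BH : factor_series beta B.
Implicit Types (a : nat -> R) (s : seq R) (L : seq (seq nat)) (c : seq nat -> R).

Definition bpart (la : seq nat) : symfun R := fun N => \prod_(k <- la) sf_R beta k N.

Lemma eval_bpart_comb a n L c :
  (forall N, sf_R a n N = \sum_(la <- L) c la *: bpart la N) ->
  forall s, fps_prod a s n = \sum_(la <- L) c la * \prod_(k <- la) fps_prod beta s k.
Proof.
move=> aE s; rewrite -meval_sf_R aE raddf_sum /=; apply: eq_bigr => la _.
rewrite mevalZ rmorph_prod; congr (_ * _).
by apply: eq_bigr => k _; exact: meval_sf_R.
Qed.

Definition lfact (la : seq nat) : R := (\prod_(k <- la) k`!)%:R.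

Lemma lfact_gt0 la : 0 < lfact la.
Proof. by rewrite ltr0n prodn_gt0 // => k; exact: fact_gt0. Qed.

Lemma prod_expc u la : \prod_(k <- la) expc u k = u ^+ sumn la / lfact la :> R.
Proof.
rewrite /expc big_split /= prodrXr sumnE; congr (_ * _).
by rewrite /lfact natr_prod prodfV.
Qed.

Definition expansion_data a n L c :=
  [/\ forall la, la \in L -> is_partition la /\ sumn la = n,
      forall la, la \in L -> 0 <= c la &
      forall s, fps_prod a s n = \sum_(la <- L) c la * \prod_(k <- la) fps_prod beta s k].

Lemma pow_bounded_le0 (A D : R) m :
  (forall w, 1 <= w -> A * w ^+ m.+1 <= D) -> A <= 0.
Proof.
move=> H; rewrite leNgt; apply/negP => A0.
pose w := `|D| / A + 1.
have w1 : 1 <= w by rewrite lerDr divr_ge0 // ltW.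
have h1 : w <= w ^+ m.+1 by rewrite exprS ler_peMr ?exprn_ege1 // (le_trans ler01).
have := le_trans (ler_wpM2l (ltW A0) h1) (H w w1).
rewrite /w mulrDr mulr1 mulrCA divff ?gt_eqF // mulr1.
by have := ler_norm D; lra.
Qed.

(* Rescaling all the variables by u compares u ^ |la| with u ^ n. *)
Lemma nonneg_comb_data a n : a 0%N = 1 ->
  nonneg_comb bpart (sf_R a n) -> exists L c, expansion_data a n L c.
Proof.
move=> a0 [L [c [_ /allP Lpart c0 aE]]].
have evalE := eval_bpart_comb aE.
have expE u : (a 1%N * u) ^+ n / n`!%:R = \sum_(la <- L) c la * (u ^+ sumn la / lfact la).
  have := expc_specialization a0 (factor_coef0 BH) evalE u [::].
  rewrite fps_prod_nil Monoid.mulm1 (factor_coef1 BH) mul1r => h.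
  rewrite -[LHS]/(expc (a 1%N * u) n) h; apply: eq_bigr => la _.
  by rewrite fps_prod_nil Monoid.mulm1 prod_expc.
have c_eq0 (la : seq nat) : la \in L -> sumn la != n -> c la = 0.
  move=> laL ne.
  have term (u : R) : 0 < u -> c la / lfact la * u ^+ sumn la <= a 1%N ^+ n / n`!%:R * u ^+ n.
    move=> u0; rewrite [leRHS]mulrAC -exprMn expE (big_rem la) //= -mulrA [_^-1 * _]mulrC lerDl.
    rewrite big_seq sumr_ge0 // => mu /mem_rem muL; rewrite mulr_ge0 ?c0 //.
    by rewrite divr_ge0 ?exprn_ge0 // ltW // lfact_gt0.
  apply/eqP; rewrite eq_le c0 // andbT.
  have : c la / lfact la <= 0; last by rewrite pmulr_lle0 ?invr_gt0 ?lfact_gt0.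
  move: ne; rewrite neq_ltn => /orP[lt|gt].
    apply: (@pow_bounded_le0 _ (a 1%N ^+ n / n`!%:R) (n - sumn la).-1) => w w1.
    have w0 : 0 < w by exact: lt_le_trans w1.
    have := term w^-1; rewrite invr_gt0 => /(_ w0).
    rewrite !exprVn -ler_pdivlMr ?invr_gt0 ?exprn_gt0 // invrK -mulrA => h.
    rewrite prednK ?subn_gt0 // -ler_pdivlMr ?exprn_gt0 //; apply: (le_trans h).
    by rewrite expfB // invf_div !mulrA mulrAC.
  apply: (@pow_bounded_le0 _ (a 1%N ^+ n / n`!%:R) (sumn la - n).-1) => w w1.
  have w0 : 0 < w by exact: lt_le_trans w1.
  rewrite prednK ?subn_gt0 // expfB // mulrA ler_pdivrMr ?exprn_gt0 //.
  exact: term.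
exists [seq la <- L | sumn la == n], c; split.
- by move=> la; rewrite mem_filter => /andP[/eqP-> /Lpart].
- by move=> la; rewrite mem_filter => /andP[_ /c0].
move=> s; rewrite evalE big_filter [RHS]big_mkcond /= !big_seq.
by apply: eq_bigr => la laL; case: eqVneq => // /(c_eq0 _ laL) ->; rewrite mul0r.
Qed.

Section Data.
Variables (a : nat -> R) (n : nat) (L : seq (seq nat)) (c : seq nat -> R).
Hypotheses (a0 : a 0%N = 1) (HL : expansion_data a n L c).

Let Ln la : la \in L -> sumn la = n. Proof. by case: HL => h _ _ /h[]. Qed.
Let c0 la : la \in L -> 0 <= c la. Proof. by case: HL => _ h _ /h. Qed.
Let evalE := let: And3 _ _ h := HL in h.

Lemma data_total : \sum_(la <- L) c la / lfact la = a 1%N ^+ n / n`!%:R.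
Proof.
have := expc_specialization a0 (factor_coef0 BH) evalE 1 [::].
rewrite fps_prod_nil Monoid.mulm1 (factor_coef1 BH) !mulr1 => h.
rewrite -[RHS]/(expc (a 1%N) n) h; apply: eq_bigr => la _.
by rewrite fps_prod_nil Monoid.mulm1 prod_expc expr1n mul1r.
Qed.

Lemma data_coef_le la : la \in L -> c la / lfact la <= a 1%N ^+ n / n`!%:R.
Proof.
move=> laL; rewrite -data_total (big_rem la) //= lerDl big_seq sumr_ge0 // => mu /mem_rem muL.
by rewrite divr_ge0 ?c0 // ltW // lfact_gt0.
Qed.

Lemma data_ge0_le : 0 <= a n <= a 1%N ^+ n.
Proof.
have b01 la : 0 <= \prod_(k <- la) beta k <= 1.
  elim: la => [|k la /andP[l u]]; first by rewrite big_nil ler01 lexx.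
  have /andP[bk0 bk1] := factor_coef01 BH k.
  by rewrite big_cons mulr_ge0 // mulr_ile1.
have -> : a n = \sum_(la <- L) c la * \prod_(k <- la) beta k.
  have one f k : fps_prod f [:: 1] k = f k :> R.
    by rewrite fps_prod_cons fps_prod_nil Monoid.mulm1 /fps_scale expr1n mulr1.
  by rewrite -one evalE; apply: eq_bigr => la _; congr (_ * _); apply: eq_bigr.
apply/andP; split.
  by rewrite big_seq sumr_ge0 // => la laL; rewrite mulr_ge0 ?c0 //; case/andP: (b01 la).
have -> : a 1%N ^+ n = \sum_(la <- L) c la * (n`!%:R / lfact la).
  have f0 : n`!%:R != 0 :> R by rewrite pnatr_eq0 -lt0n fact_gt0.
  apply: (mulIf (invr_neq0 f0)); rewrite -data_total mulr_suml; apply: eq_bigr => la _.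
  by field; rewrite f0 gt_eqF ?lfact_gt0.
rewrite !big_seq; apply: ler_sum => la laL; apply: ler_wpM2l; first exact: c0.
case/andP: (b01 la) => _ /le_trans; apply.
by rewrite ler_pdivlMr ?lfact_gt0 // mul1r ler_nat -(Ln laL) leq_prod_fact.
Qed.
End Data.
End PositiveExpansion.

Section FallingSums.
Variable R : realType.
Implicit Types (f a b : nat -> R).

Definition falling_sum f n (v : R) : R := \sum_(0 <= r < n.+1) f r * v ^+ r * ffr R n r.

Lemma falling_sum_ge0 f n v : (forall r, 0 <= f r) -> 0 <= v -> 0 <= falling_sum f n v.
Proof.
by move=> f0 v0; apply: sumr_ge0 => r _; rewrite !mulr_ge0 ?ffr_ge0 ?exprn_ge0.
Qed.

Lemma fps_mul_expc_falling (q : R) f z n : (0 < n)%N -> q != 0 ->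
  fps_mul (expc q) (fps_scale f z) n = q ^+ n / n`!%:R * falling_sum f n (n%:R * z / q).
Proof.
move=> n0 q0; have n0' : n%:R != 0 :> R by rewrite pnatr_eq0 -lt0n.
have f0 : n`!%:R != 0 :> R by rewrite pnatr_eq0 -lt0n fact_gt0.
rewrite fps_mul_expc /falling_sum !mulr_sumr !big_nat.
apply: eq_bigr => r /andP[_]; rewrite ltnS => lern.
rewrite /ffr -[in RHS](subnK lern) exprD subnK // !exprMn exprVn.
by field; rewrite f0 !expf_neq0.
Qed.

Lemma falling_sum_sqr a n (v : R) : (forall r, 0 <= a r) -> 0 <= v ->
  falling_sum (fps_mul a a) n v <= falling_sum a n v ^+ 2.
Proof.
move=> a0 v0; pose a' r := a r * v ^+ r * ffr R n r.
have a'0 r : 0 <= a' r by rewrite !mulr_ge0 ?ffr_ge0 ?exprn_ge0.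
apply: (@le_trans _ _ (\sum_(0 <= r < n.+1) fps_mul a' a' r)).
  apply: ler_sum => r _; rewrite /fps_mul !mulr_suml; apply: ler_sum => i _.
  have leir : (i <= r)%N by rewrite -ltnS.
  have -> : a' i * a' (r - i)%N
      = a i * a (r - i)%N * v ^+ r * (ffr R n i * ffr R n (r - i)).
    have -> : v ^+ r = v ^+ i * v ^+ (r - i) by rewrite -exprD subnKC.
    by rewrite /a'; ring.
  apply: ler_wpM2l; first by rewrite !mulr_ge0 ?exprn_ge0.
  by have := ffrD_le R n i (r - i); rewrite subnKC.
rewrite sum_fps_mul expr2 {2}/falling_sum mulr_suml.
apply: ler_sum => i _; apply: ler_wpM2l => //.
rewrite /falling_sum (big_cat_nat _ (leq_subr i n.+1)) //= lerDl.
by apply: sumr_ge0 => r _; exact: a'0.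
Qed.

Lemma falling_sum_approx b m (y S : R) :
  (forall r, 0 <= b r <= r.+1%:R) -> 0 <= y <= 8^-1 -> (0 < m)%N ->
  series (fun r => b r * y ^+ r) @ \oo --> S ->
  falling_sum b m y <= S <= falling_sum b m y + 48 * (y ^+ 2 / m%:R).
Proof.
move=> b01 /andP[y0 y8] m0 bS.
have m0' : 0 < m%:R :> R by rewrite ltr0n.
have b0 r : 0 <= b r by case/andP: (b01 r).
pose C : R := 24 * (y ^+ 2 / m%:R).
have C0 : 0 <= C by rewrite mulr_ge0 // divr_ge0 ?sqr_ge0 // ltW.
have cubic k : ((k.+3 * k.+2 * k.+1)%:R <= 6 * 4 ^+ k :> R).
  have -> : 6 * 4 ^+ k = (6 * 4 ^ k)%N%:R :> R by rewrite natrM natrX.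
  rewrite ler_nat; elim: k => // k IHk; rewrite expnS; nia.
have term r : 0 <= b r * y ^+ r * (1 - ffr R m r) <= C * 2^-1 ^+ r.
  apply/andP; split.
    by rewrite !mulr_ge0 ?exprn_ge0 // subr_ge0 ffr_le1.
  have g := ffr_ge R r m0; have /andP[_ b1] := b01 r.
  have yr : 0 <= y ^+ r by rewrite exprn_ge0.
  apply: (@le_trans _ _ (r.+1%:R * y ^+ r * ((r * r.-1)%:R / m%:R))).
    by apply: ler_pM => //; rewrite ?mulr_ge0 // ?subr_ge0 ?ffr_le1 // ler_wpM2r.
  case: r {g b1 yr} => [|[|k]];
    rewrite ?mul0n ?muln0 ?mul0r ?mulr0 ?mulr_ge0 ?exprn_ge0 ?invr_ge0 //.
  have e2 (w : R) : w ^+ k.+2 = w ^+ k * w ^+ 2 by rewrite -exprD addn2.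
  have -> : k.+3%:R * y ^+ k.+2 * ((k.+2 * k.+1)%:R / m%:R)
     = (k.+3 * k.+2 * k.+1)%:R * y ^+ k * (y ^+ 2 / m%:R) :> R.
    by rewrite !natrM e2; ring.
  have -> : C * 2^-1 ^+ k.+2 = 6 * 2^-1 ^+ k * (y ^+ 2 / m%:R) :> R.
    by rewrite e2 /C; field; rewrite gt_eqF.
  apply: ler_wpM2r; first by rewrite divr_ge0 ?sqr_ge0 // ltW.
  apply: (@le_trans _ _ (6 * 4 ^+ k * y ^+ k)).
    by apply: ler_wpM2r; rewrite ?exprn_ge0 // cubic.
  rewrite -mulrA -exprMn; apply: ler_wpM2l => //.
  by apply: lerXn2r; rewrite ?nnegrE ?mulr_ge0 ?invr_ge0 //; lra.
have big_tail N : (m < N)%N -> \sum_(0 <= r < N) b r * y ^+ r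
   = falling_sum b m y + \sum_(0 <= r < N) b r * y ^+ r * (1 - ffr R m r).
  move=> ltmN; suff -> : falling_sum b m y = \sum_(0 <= r < N) b r * y ^+ r * ffr R m r.
    by rewrite -big_split /=; apply: eq_bigr => r _; ring.
  rewrite [RHS](big_cat_nat _ ltmN) //= [X in _ + X]big_nat [X in _ + X]big1 ?addr0 //.
  by move=> r /andP[ltmr _]; rewrite /ffr ffact_small // mul0r mulr0.
apply/andP; split.
  apply: (cvgr_to_ge bS); near=> N; have ltmN : (m < N)%N by near: N; exists m.+1.
  rewrite /series /= big_tail // lerDl sumr_ge0 // => r _.
  by case/andP: (term r).
apply: (cvgr_to_le bS); near=> N; have ltmN : (m < N)%N by near: N; exists m.+1.
rewrite /series /= big_tail // lerD2l.
apply: (@le_trans _ _ (\sum_(0 <= r < N) C * 2^-1 ^+ r)).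
  by apply: ler_sum => r _; case/andP: (term r).
have h := @cvg_geometric_series R C 2^-1.
have -> : 48 * (y ^+ 2 / m%:R) = C / (1 - 2^-1) :> R by rewrite /C; field; rewrite gt_eqF.
rewrite -(cvg_lim _ (h _)) //; last by rewrite ger0_norm ?invr_ge0 // invf_lt1 // ltr1n.
apply: (@nondecreasing_cvgn_le _ (series (geometric C 2^-1))).
  apply/nondecreasing_seqP => k; rewrite seriesSr lerDl /=.
  by rewrite mulr_ge0 // exprn_ge0 // invr_ge0.
by apply: is_cvg_geometric_series; rewrite ger0_norm ?invr_ge0 // invf_lt1 // ltr1n.
Unshelve. all: by end_near. Qed.

Lemma prod_diff_le (I : eqType) (r : seq I) (D E : I -> R) :
  (forall i, i \in r -> 0 <= D i <= E i) -> (forall i, i \in r -> 1 <= E i) ->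
  \prod_(i <- r) E i <= \prod_(i <- r) D i + (\sum_(i <- r) (E i - D i)) * \prod_(i <- r) E i.
Proof.
elim: r => [|i r IHr] DE E1; first by rewrite !big_nil mul0r addr0.
rewrite !big_cons; have /andP[d0 de] := DE i (mem_head _ _).
have e1 := E1 i (mem_head _ _).
have sub j : j \in r -> j \in i :: r by rewrite in_cons => ->; rewrite orbT.
have {}IHr := IHr (fun j jr => DE j (sub j jr)) (fun j jr => E1 j (sub j jr)).
have P1 : 1 <= \prod_(j <- r) E j.
  rewrite big_seq; elim/big_ind: _ => [||j /sub/E1] //.
  by move=> x y x1 y1; rewrite mulr_ege1.
have S0 : 0 <= \sum_(j <- r) (E j - D j).
  by rewrite big_seq sumr_ge0 // => j /sub/DE/andP[_]; rewrite subr_ge0.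
move: IHr P1 S0; set PE := \prod_(j <- r) E j; set PD := \prod_(j <- r) D j.
set S := \sum_(j <- r) (E j - D j) => IHr P1 S0.
have PE0 : 0 <= PE by exact: le_trans P1.
have h1 : D i * PE <= D i * PD + D i * (S * PE) by rewrite -mulrDr; exact: ler_wpM2l.
have h2 : D i * (S * PE) <= E i * (S * PE) by apply: ler_wpM2r => //; exact: mulr_ge0.
have h3 : (E i - D i) * PE <= (E i - D i) * (E i * PE).
  by apply: ler_wpM2l; [rewrite subr_ge0|rewrite ler_peMl].
have -> : (E i - D i + S) * (E i * PE) = (E i - D i) * (E i * PE) + E i * (S * PE) by ring.
have -> : E i * PE = (E i - D i) * PE + D i * PE by ring.
lra.
Qed.

End FallingSums.

Section Concentration.
Variables (R : realType) (beta : nat -> R) (B : R -> R).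
Hypothesis BH : factor_series beta B.
Variables (a : nat -> R) (n : nat) (L : seq (seq nat)) (c : seq nat -> R).
Hypotheses (a0 : a 0%N = 1) (a_ge0 : forall r, 0 <= a r).
Hypothesis HL : expansion_data beta a n L c.
Hypotheses (n_gt0 : (0 < n)%N) (p_gt0 : 0 < a 1%N).

Let p := a 1%N.
Let Ln la : la \in L -> sumn la = n. Proof. by case: HL => h _ _ /h[]. Qed.
Let c0 la : la \in L -> 0 <= c la. Proof. by case: HL => _ h _ /h. Qed.
Let Lpos la k : la \in L -> k \in la -> (0 < k)%N.
Proof. by case: HL => h _ _ /h[/andP[_ /allP lapos] _] /lapos. Qed.
Let evalE := let: And3 _ _ h := HL in h.
Let n0 : 0 < n%:R :> R. Proof. by rewrite ltr0n. Qed.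
Let fact0 : 0 < n`!%:R :> R. Proof. by rewrite ltr0n fact_gt0. Qed.

Definition weight (la : seq nat) : R := n`!%:R * c la / (lfact R la * p ^+ n).

Definition rescale (la : seq nat) : seq R := [seq p * k%:R / n%:R | k <- la].

Lemma weight_ge0 la : la \in L -> 0 <= weight la.
Proof.
by move=> laL; rewrite divr_ge0 ?mulr_ge0 ?c0 ?exprn_ge0 // ltW // lfact_gt0.
Qed.

Lemma weight_sum : \sum_(la <- L) weight la = 1.
Proof.
have pn : p ^+ n != 0 by rewrite expf_neq0 // gt_eqF.
have <- : n`!%:R / p ^+ n * (\sum_(la <- L) c la / lfact R la) = 1.
  by rewrite (data_total BH a0 HL) -/p; field; rewrite pn gt_eqF.
rewrite mulr_sumr; apply: eq_bigr => la _; rewrite /weight; field.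
by rewrite pn gt_eqF ?lfact_gt0.
Qed.

Lemma rescale_sum la : la \in L -> \sum_(x <- rescale la) x = p.
Proof.
move=> laL; rewrite big_map -mulr_suml -mulr_sumr -natr_sum -sumnE Ln //.
by rewrite mulfK // gt_eqF.
Qed.

Section AtPoint.
Variable v : R.
Hypotheses (v0 : 0 <= v) (pv : p * v <= 8^-1).

Let y (k : nat) : R := k%:R * (p * v / n%:R).

Let y0 k : 0 <= y k.
Proof. by rewrite mulr_ge0 // divr_ge0 // ?mulr_ge0 // ltW. Qed.

Let y_sum la : la \in L -> \sum_(k <- la) y k = p * v.
Proof.
by move=> laL; rewrite -mulr_suml -natr_sum -sumnE Ln // mulrC divfK // gt_eqF.
Qed.

Let y_le la k : la \in L -> k \in la -> y k <= p * v.
Proof.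
move=> laL kla; rewrite -(y_sum laL) (big_rem k) //= lerDl sumr_ge0 // => i _; exact: y0.
Qed.

Let y_half la k : la \in L -> k \in la -> `|y k| <= 2^-1.
Proof.
move=> laL kla; rewrite ger0_norm //; apply: (le_trans (y_le laL kla)).
by apply: (le_trans pv); lra.
Qed.

Lemma qprod_rescale la : qprod B (rescale la) v = \prod_(k <- la) B (y k).
Proof.
by rewrite /qprod big_map; apply: eq_bigr => k _; congr B; rewrite /y; ring.
Qed.

Lemma weight_identity s f g :
  fps_prod a s = fps_scale g (p * v / n%:R) ->
  fps_prod beta s = fps_scale f (p * v / n%:R) ->
  \sum_(la <- L) weight la * \prod_(k <- la) falling_sum f k (y k) = falling_sum g n v.
Proof.
move=> aE bE; have pn : p ^+ n != 0 by rewrite expf_neq0 // gt_eqF.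
have := expc_specialization a0 (factor_coef0 BH) evalE 1 s.
rewrite aE bE (factor_coef1 BH) !mulr1 -/p fps_mul_expc_falling ?gt_eqF //.
have -> : n%:R * (p * v / n%:R) / p = v by field; rewrite !gt_eqF.
move=> h; have -> : falling_sum g n v
    = n`!%:R / p ^+ n * (p ^+ n / n`!%:R * falling_sum g n v).
  by field; rewrite pn gt_eqF.
rewrite h mulr_sumr !big_seq; apply: eq_bigr => la laL.
have -> : \prod_(k <- la) fps_mul (expc 1) (fps_scale f (p * v / n%:R)) k
    = (lfact R la)^-1 * \prod_(k <- la) falling_sum f k (y k).
  rewrite /lfact natr_prod -prodfV -big_split /= !big_seq; apply: eq_bigr => k kla.
  rewrite fps_mul_expc_falling ?oner_neq0 ?(Lpos laL kla) //.
  by rewrite expr1n div1r divr1.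
by rewrite /weight; field; rewrite pn gt_eqF ?lfact_gt0.
Qed.

Lemma mean_qprod_ge :
  falling_sum a n v <= \sum_(la <- L) weight la * qprod B (rescale la) v.
Proof.
rewrite -(@weight_identity [:: p * v / n%:R] beta a); last 2 first.
- by rewrite fps_prod_cons fps_prod_nil Monoid.mulm1.
- by rewrite fps_prod_cons fps_prod_nil Monoid.mulm1.
rewrite !big_seq; apply: ler_sum => la laL; apply: ler_wpM2l; first exact: weight_ge0.
rewrite qprod_rescale !big_seq; apply: ler_prod => k kla.
have b01 r : 0 <= beta r <= r.+1%:R.
  by have /andP[-> /le_trans] := factor_coef01 BH r; apply; rewrite ler1n.
rewrite falling_sum_ge0 => [||//]; last first.
  by move=> r; case/andP: (factor_coef01 BH r).
have y8 : 0 <= y k <= 8^-1 by rewrite y0 (le_trans (y_le laL kla)).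
by case/andP: (falling_sum_approx b01 y8 (Lpos laL kla) (factor_cvg BH (y_half laL kla))).
Qed.

Lemma qprod_rescale_sqr_le la : la \in L -> qprod B (rescale la) v ^+ 2 <= expR 1.
Proof.
move=> laL; have B0 k : k \in la -> 0 <= B (y k).
  by move=> kla; rewrite ltW // (B_gt0 BH) // (y_half laL kla).
have Q0 : 0 <= \prod_(k <- la) B (y k) by rewrite big_seq prodr_ge0.
rewrite qprod_rescale; apply: (@le_trans _ _ (expR (2 * (p * v)) ^+ 2)); last first.
  by rewrite -expRM_natr ler_expR; move: pv; lra.
apply: lerXn2r; rewrite ?nnegrE ?expR_ge0 //.
rewrite -(y_sum laL) mulr_sumr expR_sum !big_seq; apply: ler_prod => k kla.
rewrite B0 //=; have /andP[_ /le_trans] := factor_bound BH (y_half laL kla); apply.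
rewrite ler_expR; have := y0 k; have := y_half laL kla; rewrite ger0_norm //; nra.
Qed.

Lemma mean_sqr_qprod_le :
  \sum_(la <- L) weight la * qprod B (rescale la) v ^+ 2
  <= falling_sum (fps_mul a a) n v + expR 1 / n%:R.
Proof.
pose z := p * v / n%:R.
rewrite -(@weight_identity [:: z; z] (fps_mul beta beta) (fps_mul a a)); last 2 first.
- by rewrite !fps_prod_cons fps_prod_nil Monoid.mulm1 fps_scale_mul.
- by rewrite !fps_prod_cons fps_prod_nil Monoid.mulm1 fps_scale_mul.
have -> : expR 1 / n%:R = \sum_(la <- L) weight la * (expR 1 / n%:R) :> R.
  by rewrite -mulr_suml weight_sum mul1r.
rewrite -big_split /= !big_seq; apply: ler_sum => la laL; rewrite -mulrDr.
apply: ler_wpM2l; first exact: weight_ge0.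
have bb01 r : 0 <= fps_mul beta beta r <= r.+1%:R.
  apply/andP; split.
    by apply: sumr_ge0 => i _; rewrite mulr_ge0 //; case/andP: (factor_coef01 BH i);
       case/andP: (factor_coef01 BH (r - i)).
  rewrite -[in leRHS](card_ord r.+1) -sumr_const; apply: ler_sum => i _.
  by have /andP[? ?] := factor_coef01 BH i; have /andP[? ?] := factor_coef01 BH (r - i);
     rewrite mulr_ile1.
have approx k : k \in la -> falling_sum (fps_mul beta beta) k (y k) <= B (y k) ^+ 2
    <= falling_sum (fps_mul beta beta) k (y k) + 48 * (y k ^+ 2 / k%:R).
  move=> kla; apply: falling_sum_approx => //.
  - by rewrite y0 (le_trans (y_le laL kla)).
  - exact: Lpos kla.
  rewrite expr2 -/(fps_scale _ _) fps_scale_mul.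
  have yk := y_half laL kla; have Bk := factor_cvg BH yk.
  by apply: cauchy_product; [exact: (factor_norm_cvg BH yk)|exact: Bk|exact: Bk].
have sqrE : qprod B (rescale la) v ^+ 2 = \prod_(k <- la) B (y k) ^+ 2.
  by rewrite qprod_rescale prodrXl.
pose D k := falling_sum (fps_mul beta beta) k (y k).
rewrite {1}sqrE; apply: le_trans (@prod_diff_le _ _ _ D _ _ _) _.
- move=> k kla; case/andP: (approx k kla) => -> _; rewrite andbT.
  by apply: falling_sum_ge0 => // r; case/andP: (bb01 r).
- move=> k kla; rewrite exprn_ege1 //.
  have /andP[/(le_trans _) + _] := factor_bound BH (y_half laL kla); apply.
  rewrite -[leLHS]expR0 ler_expR; have := y0 k; have := y_half laL kla.
  by rewrite ger0_norm //; nra.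
rewrite lerD2l -sqrE mulrC; apply: ler_pM.
- exact: sqr_ge0.
- by rewrite big_seq sumr_ge0 // => k /approx/andP[]; rewrite subr_ge0.
- exact: qprod_rescale_sqr_le.
apply: (@le_trans _ _ (\sum_(k <- la) 48 * (p * v / n%:R) * y k)).
  rewrite !big_seq; apply: ler_sum => k kla.
  have /andP[_] := approx k kla; rewrite -lerBlDl => /le_trans; apply.
  rewrite -mulrA; apply: ler_wpM2l => //; rewrite expr2 mulrAC; apply: ler_wpM2r => //.
  by rewrite /y mulrAC divff ?mul1r // gt_eqF // ltr0n (Lpos laL kla).
rewrite -mulr_sumr (y_sum laL).
have pv0 : 0 <= p * v by rewrite mulr_ge0 // ltW.
have -> : 48 * (p * v / n%:R) * (p * v) = 48 * (p * v) ^+ 2 / n%:R by ring.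
rewrite -[leRHS]mul1r; apply: ler_wpM2r; first by rewrite invr_ge0 ltW.
move: pv pv0; move: (p * v) => P; nra.
Qed.

Lemma variance_le :
  \sum_(la <- L) weight la * (qprod B (rescale la) v - falling_sum a n v) ^+ 2
  <= expR 1 / n%:R.
Proof.
have f0 : 0 <= falling_sum a n v by exact: falling_sum_ge0.
have h1 := mean_qprod_ge; have h2 := mean_sqr_qprod_le.
have h3 := @falling_sum_sqr R a n v a_ge0 v0.
move: (falling_sum a n v) f0 h1 h3 => f f0 h1 h3.
have -> : \sum_(la <- L) weight la * (qprod B (rescale la) v - f) ^+ 2
  = \sum_(la <- L) weight la * qprod B (rescale la) v ^+ 2
    - 2 * f * (\sum_(la <- L) weight la * qprod B (rescale la) v)
    + f ^+ 2 * \sum_(la <- L) weight la.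
  rewrite !mulr_sumr -sumrB -big_split /=; apply: eq_bigr => la _.
  by move: (weight la) (qprod B _ v) => w q; ring.
rewrite weight_sum mulr1; have h4 := ler_wpM2l f0 h1.
rewrite expr2 in h3 *; rewrite -[2 * f * _]mulrA.
move: h2 h3 h4; move: (\sum_(la <- L) _) (\sum_(la <- L) _) => A1 A2.
move: (falling_sum _ _ _) (f * f) (f * _) (expR 1 / _) => A3 A4 A5 A6; lra.
Qed.
End AtPoint.
End Concentration.

Lemma exists_le_mean (R : realType) (I : eqType) (r : seq I) (W X : I -> R) (K : R) :
  (forall i, i \in r -> 0 <= W i) -> \sum_(i <- r) W i = 1 ->
  \sum_(i <- r) W i * X i <= K -> exists2 i, i \in r & X i <= K.
Proof.
move=> W0 W1 WX; case: (boolP (has (fun i => X i <= K) r)) => [/hasP //|].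
move=> /hasPn gtK; have {}gtK i : i \in r -> 0 < X i - K.
  by move=> /gtK; rewrite -ltNge subr_gt0.
have W0' i : i \in r -> 0 <= W i * (X i - K).
  by move=> ir; rewrite mulr_ge0 ?W0 // ltW // gtK.
have sum0 : \sum_(i <- r | i \in r) W i * (X i - K) = 0.
  apply/eqP; rewrite eq_le sumr_ge0 // andbT -big_seq.
  under eq_bigr do rewrite mulrBr.
  by rewrite sumrB -mulr_suml W1 mul1r subr_le0.
have all0 i : i \in r -> W i = 0.
  move=> ir; move/eqP: sum0; rewrite psumr_eq0 // => /allP/(_ i ir); rewrite ir /= mulf_eq0.
  by rewrite (gt_eqF (gtK i ir)) orbF => /eqP.
move: W1; rewrite big_seq big1 // => /esym/eqP; by rewrite oner_eq0.
Qed.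

Lemma cvg_of_sqr (R : realType) (F : set_system nat) (FF : Filter F) (u : nat -> R) :
  u n ^+ 2 @[n --> F] --> (0 : R) -> u @ F --> (0 : R).
Proof.
move=> u2; apply/cvgrPdist_le => e e0.
have e2 : 0 < e ^+ 2 by rewrite exprn_gt0.
have /cvgrPdist_le/(_ _ e2) := u2; apply: filterS => n.
rewrite !sub0r !normrN normrX => h.
by move: h; rewrite ler_sqr // nnegrE // ltW.
Qed.

Section ForwardDirection.
Variables (R : realType) (beta : nat -> R) (B : R -> R).
Hypothesis BH : factor_series beta B.

Lemma falling_sum_cvg (a : nat -> R) (p v T : R) :
  (forall r, `|a r| <= p ^+ r) -> 0 <= p -> `|v| * p <= 2^-1 ->
  series (fun r => a r * v ^+ r) @ \oo --> T ->
  falling_sum a n.+1 v @[n --> \oo] --> T.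
Proof.
move=> ap p0 vp aT.
have ap1 r : `|a r| <= 1 * p ^+ r by rewrite mul1r.
pose f n r := a r * v ^+ r * ffr R n.+1 r.
have fM n r : `|f n r| <= 1 * 2^-1 ^+ r.
  rewrite /f normrM; apply: le_trans (term_le_half r ap1 p0 vp).
  by rewrite ler_piMr // ger0_norm ?ffr_ge0 // ffr_le1.
have fb r : f ^~ r @ \oo --> a r * v ^+ r.
  rewrite -[X in _ --> X]mulr1; apply: cvgMl_tmp.
  by rewrite (cvg_shiftS (fun n => ffr R n r)); exact: cvg_ffr.
have fS n : series (f n) @ \oo --> falling_sum a n.+1 v.
  apply: cvg_near_cst; exists n.+2 => // m /= nm.
  rewrite /series /= (big_cat_nat _ nm) //= [X in _ + X]big_nat [X in _ + X]big1 ?addr0 //.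
  by move=> r /andP[ltnr _]; rewrite /f /ffr ffact_small // mul0r mulr0.
have [T' aT'] := tannery _ fM (@cvg_series_half _ _) fb fS.
by rewrite (cvg_unique _ aT aT').
Qed.

Lemma good_partition (a : nat -> R) (v : nat -> R) n :
  a 0%N = 1 -> (forall r, 0 <= a r <= a 1%N ^+ r) ->
  (forall j, 0 <= v j) -> (forall j, a 1%N * v j <= 8^-1) ->
  (exists L c, expansion_data beta a n.+1 L c) ->
  exists s : seq R, [/\ sorted >=%R s, all (fun x => 0 <= x) s, \sum_(x <- s) x = a 1%N &
    forall j, (j <= n)%N ->
      (qprod B s (v j) - falling_sum a n.+1 (v j)) ^+ 2 <= 2 ^+ j.+1 * (expR 1 / n.+1%:R)].
Proof.
move=> a0 a01 v0 pv [L [c HL]]; set p := a 1%N.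
have a_ge0 r : 0 <= a r by case/andP: (a01 r).
have := a_ge0 1%N; rewrite -/p le_eqVlt => /orP[/eqP p0|p0].
  exists [::]; split => // [|j _]; first by rewrite big_nil.
  rewrite /qprod big_nil /falling_sum big_nat_recl //= big1 => [|r _].
    rewrite a0 expr0 ffr0 !mulr1 addr0 subrr expr0n mulr_ge0 ?exprn_ge0 // divr_ge0 ?expR_ge0 //.
  have := a01 r.+1; rewrite -/p -p0 exprS mul0r => /le_anti <-.
  by rewrite !mul0r.
have W0 := weight_ge0 HL p0; have W1 := weight_sum BH a0 HL p0.
pose X la : R := \sum_(0 <= j < n.+1) 2^-1 ^+ j.+1 *
  (qprod B (rescale a n.+1 la) (v j) - falling_sum a n.+1 (v j)) ^+ 2.
have half0 j : 0 <= (2^-1 : R) ^+ j by rewrite exprn_ge0 // invr_ge0.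
have /(exists_le_mean W0 W1)[la laL Xla] :
    \sum_(la <- L) weight a n.+1 c la * X la <= expR 1 / n.+1%:R.
  under eq_bigr do rewrite mulr_sumr.
  rewrite exchange_big /=.
  apply: (@le_trans _ _ (\sum_(0 <= j < n.+1) 2^-1 ^+ j.+1 * (expR 1 / n.+1%:R))).
    apply: ler_sum => j _; under eq_bigr do rewrite mulrCA.
    rewrite -mulr_sumr; apply: ler_wpM2l => //.
    exact: (variance_le BH a0 a_ge0 HL _ p0 (v0 j) (pv j)).
  rewrite -mulr_suml ler_piMl ?divr_ge0 ?expR_ge0 //.
  elim: (n.+1) => [|m IHm]; first by rewrite big_nil.
  rewrite big_nat_recl //=.
  under eq_bigr do rewrite exprS.
  by rewrite -mulr_sumr expr1; lra.
exists (rescale a n.+1 la); split.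
- have /(_ la laL)[/andP[laS _] _] := let: And3 h _ _ := HL in h.
  rewrite sorted_map; apply: sub_sorted laS => k l /= lek.
  by rewrite ler_wpM2r ?invr_ge0 // ler_wpM2l ?ler_nat // ltW.
- apply/allP => _ /mapP[k _ ->]; by rewrite divr_ge0 // mulr_ge0 // ltW.
- exact: (rescale_sum HL).
move=> j lejn; have : 2^-1 ^+ j.+1 *
    (qprod B (rescale a n.+1 la) (v j) - falling_sum a n.+1 (v j)) ^+ 2 <= expR 1 / n.+1%:R.
  apply: le_trans Xla; rewrite /X (big_rem j) ?mem_index_iota //= lerDl.
  by apply: sumr_ge0 => i _; rewrite mulr_ge0 // sqr_ge0.
by rewrite exprVn mulrC ler_pdivrMr ?exprn_gt0 // [leRHS]mulrC.
Qed.

Theorem positive_expansion (a : nat -> R) : a 0%N = 1 ->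
  (forall n, nonneg_comb (bpart beta) (sf_R a n)) ->
  exists (gamma : R) (alpha : nat -> R),
    [/\ 0 <= gamma, (forall j, 0 <= alpha j), cvgn (series alpha) &
        is_expansion a (fun t => expR (gamma * t) * infprod (fun j => B (alpha j * t)))].
Proof.
move=> a0 pos; have data n := nonneg_comb_data BH a0 (pos n).
have a01 r : 0 <= a r <= a 1%N ^+ r.
  by have [L [c HL]] := data r; exact: (data_ge0_le BH a0 HL).
set p := a 1%N; have p0 : 0 <= p by case/andP: (a01 1%N).
have ap r : `|a r| <= p ^+ r by rewrite ger0_norm; case/andP: (a01 r).
pose v j : R := (8 * (p + 1))^-1 * j.+1%:R^-1.
have P0 : 0 < 8 * (p + 1) by rewrite mulr_gt0 // ltr_wpDl.
have v0 j : 0 < v j by rewrite mulr_gt0 // invr_gt0.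
have vp j : p * v j <= 8^-1.
  apply: (@le_trans _ _ (p / (8 * (p + 1)))).
    rewrite ler_wpM2l // ler_piMr ?invr_ge0 ?(ltW P0) // invf_le1 ?ler1n ?ltr0n //.
  by rewrite ler_pdivrMr // mulrA mulVf // mul1r lerDl.
have vp2 j : `|v j| * p <= 2^-1.
  by rewrite gtr0_norm // mulrC; apply: (le_trans (vp j)); lra.
have cvgv : v @ \oo --> (0 : R).
  rewrite -[X in _ --> X](mulr0 (8 * (p + 1))^-1); apply: cvgMl_tmp; exact: cvg_harmonic.
have /choice[s sP] n := good_partition a0 a01 (fun j => ltW (v0 j)) vp (data n.+1).
have sS n : sorted >=%R (s n) by case: (sP n).
have s0 n : all (fun x => 0 <= x) (s n) by case: (sP n).
have sE n : \sum_(x <- s n) x = p by case: (sP n).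
have [U [UU ooU]] := @ultraFilterLemma _ (\oo : set_system nat) _.
have UP : ProperFilter U by exact: ultra_proper.
have [gamma [alpha [gamma0 alpha0 calpha qG]]] := ultra_product BH UU sS s0 sE.
exists gamma, alpha; split => //.
have sle n : \sum_(x <- s n) x <= p by rewrite sE.
have [q [qP qle qser]] := ultra_coef BH UU s0 sle.
have a_eq_q r : q r = a r.
  apply/eqP; rewrite -subr_eq0; apply/eqP; move: r.
  apply: (@power_series_eq0 R (fun r => q r - a r) 2 p v) => // [k|j|j].
  - by apply: (le_trans (ler_normB _ _)); have := qle k; have := ap k; lra.
  - by have := vp2 j; rewrite gtr0_norm.
  have ap1 r : `|a r| <= 1 * p ^+ r by rewrite mul1r.
  have /cvg_ex[/= T aT] := power_series_cvg ap1 p0 (vp2 j).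
  have QT : qprod B (s n) (v j) @[n --> \oo] --> T.
    have -> : T = 0 + T by rewrite add0r.
    have -> : (fun n => qprod B (s n) (v j)) = (fun n =>
        (qprod B (s n) (v j) - falling_sum a n.+1 (v j)) + falling_sum a n.+1 (v j)).
      by apply: funext => n; rewrite subrK.
    apply: cvgD; last exact: falling_sum_cvg aT.
    apply: cvg_of_sqr.
    have h : 2 ^+ j.+1 * (expR 1 / n.+1%:R) @[n --> \oo] --> (0 : R).
      rewrite -[X in _ --> X](mulr0 (2 ^+ j.+1 * expR 1)).
      under eq_cvg do rewrite mulrA.
      by apply: cvgMl_tmp; exact: cvg_harmonic.
    apply: (@squeeze_cvgr _ _ _ _ (fun=> 0) _ _ _ _ _ h); [near=> n|exact: cvg_cst].
    rewrite sqr_ge0 /=; have [_ _ _ -> //] := sP n.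
    by near: n; exists j.
  have QU : qprod B (s n) (v j) @[n --> U] --> T by move=> A /QT; exact: ooU.
  have qT := qser _ _ (vp2 j) QU.
  rewrite -(subrr T).
  have -> : series (fun r => (q r - a r) * v j ^+ r)
      = series (fun r => q r * v j ^+ r) - series (fun r => a r * v j ^+ r).
    rewrite -seriesN -seriesD; congr series; apply: funext => r /=.
    by rewrite mulrBl.
  exact: cvgB.
exists (2 * (p + 1))^-1; first by rewrite invr_gt0 mulr_gt0 // ltr_wpDl.
move=> t tr; have tp : `|t| * p <= 2^-1.
  apply: (@le_trans _ _ ((2 * (p + 1))^-1 * p)); first by rewrite ler_wpM2r // ltW.
  by rewrite invfM -mulrA ler_piMr ?invr_ge0 // mulrC ler_pdivrMr ?mul1r ?lerDl // ltr_wpDl.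
have -> : (fun r => a r * t ^+ r) = (fun r => q r * t ^+ r).
  by apply: funext => r; rewrite a_eq_q.
exact: qser tp (qG _ tp).
Unshelve. all: by end_near. Qed.
End ForwardDirection.

Fixpoint bounded_seqs (n k : nat) : seq (seq nat) :=
  if k is k'.+1 then
    [::] :: [seq x :: l | x <- iota 0 n.+1, l <- bounded_seqs n k']
  else [:: [::]].

Lemma mem_bounded_seqs n k (la : seq nat) :
  (size la <= k)%N -> all (geq n) la -> la \in bounded_seqs n k.
Proof.
elim: k la => [|k IHk] [|x la] // szla /andP[xn lan].
rewrite in_cons orFb; apply: (@allpairs_f _ _ _ (fun x l => x :: l)); last exact: IHk.
by rewrite mem_iota /= add0n ltnS.
Qed.

Definition partitions (n : nat) : seq (seq nat) :=
  undup [seq la <- bounded_seqs n n | is_partition la && (sumn la == n)].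

Lemma mem_partitions n (la : seq nat) : (la \in partitions n) = is_partition la && (sumn la == n).
Proof.
rewrite mem_undup mem_filter.
case: (boolP (is_partition la && (sumn la == n))) => //= /andP[/andP[_ pos] /eqP sumE].
apply: mem_bounded_seqs.
  rewrite -sumE; elim: la pos {sumE} => //= k la IH /andP[k0 /IH]; lia.
apply/allP => k kla; rewrite /= -sumE; elim: la kla {pos sumE} => //= l la IH.
by rewrite in_cons => /orP[/eqP->|/IH]; lia.
Qed.

Section Cone.
Variables (R : realType) (beta : nat -> R) (B : R -> R).
Hypothesis BH : factor_series beta B.
Implicit Types (f : symfun R) (n : nat).

Definition bcone n f := exists2 c : seq nat -> R, (forall la, 0 <= c la) &
  forall N, f N = \sum_(la <- partitions n) c la *: bpart beta la N.

Lemma bcone_ext n f g : (forall N, f N = g N) -> bcone n f -> bcone n g.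
Proof. by move=> fg [c c0 fE]; exists c => // N; rewrite -fg. Qed.

Lemma bcone0 n : bcone n (fun=> 0).
Proof. by exists (fun=> 0) => // N; rewrite big1 // => la _; rewrite scale0r. Qed.

Lemma bconeD n f g : bcone n f -> bcone n g -> bcone n (fun N => f N + g N).
Proof.
move=> [c c0 fE] [d d0 gE]; exists (fun la => c la + d la) => [la|N].
  by rewrite addr_ge0.
by rewrite fE gE -big_split; apply: eq_bigr => la _; rewrite scalerDl.
Qed.

Lemma bconeZ n (x : R) f : 0 <= x -> bcone n f -> bcone n (fun N => x *: f N).
Proof.
move=> x0 [c c0 fE]; exists (fun la => x * c la) => [la|N]; first by rewrite mulr_ge0.
by rewrite fE scaler_sumr; apply: eq_bigr => la _; rewrite scalerA.
Qed.

Lemma bcone_sum n (I : eqType) (r : seq I) (F : I -> symfun R) :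
  (forall i, i \in r -> bcone n (F i)) -> bcone n (fun N => \sum_(i <- r) F i N).
Proof.
elim: r => [|i r IHr] Fr.
  by apply: bcone_ext (bcone0 n) => N; rewrite big_nil.
apply: (@bcone_ext _ (fun N => F i N + \sum_(j <- r) F j N)).
  by move=> N; rewrite big_cons.
apply: bconeD; first by apply: Fr; rewrite mem_head.
by apply: IHr => j jr; apply: Fr; rewrite in_cons jr orbT.
Qed.

Lemma bcone_part n la : la \in partitions n -> bcone n (bpart beta la).
Proof.
move=> lan; exists (fun mu => (mu == la)%:R) => [mu|N]; first by rewrite ler0n.
rewrite (bigD1_seq la) ?undup_uniq //= eqxx scale1r big1 ?addr0 // => mu /negPf->.
by rewrite scale0r.
Qed.

Lemma sf_R_deg0 N : sf_R beta 0 N = 1.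
Proof.
apply/mpolyP => m; rewrite mcoeff_sf_R mcoeff1 mdeg_eq0; case: eqP => [->|_]; last by rewrite mul0r.
by rewrite mul1r big1 // => i _; rewrite mnm0E (factor_coef0 BH).
Qed.

Lemma bcone_mul n k f : (k <= n)%N -> bcone (n - k) f ->
  bcone n (fun N => sf_R beta k N * f N).
Proof.
case: k => [|k] lekn.
  by rewrite subn0; apply: bcone_ext => N; rewrite sf_R_deg0 mul1r.
move=> [c c0 fE].
apply: (@bcone_ext _ (fun N => \sum_(la <- partitions (n - k.+1))
    c la *: bpart beta (sort geq (k.+1 :: la)) N)).
  move=> N; rewrite fE mulr_sumr; apply: eq_bigr => la _.
  by rewrite -scalerAr /bpart (perm_big _ (permEl (perm_sort _ _))) big_cons.
apply: bcone_sum => la; rewrite mem_partitions => /andP[/andP[_ pos] /eqP sumE].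
apply: bconeZ => //; apply: bcone_part; rewrite mem_partitions /is_partition.
rewrite sort_sorted; last by move=> x y; exact: leq_total.
rewrite all_sort /= pos /= (perm_sumn (permEl (perm_sort _ _))) /= sumE.
by rewrite subnKC.
Qed.

Lemma bcone_fps_prod s n : all (fun x => 0 <= x) s ->
  bcone n (sf_R (fps_prod beta s) n).
Proof.
elim: s n => [|x s IHs] n /=.
  move=> _; rewrite fps_prod_nil; case: n => [|n].
    apply: bcone_ext (@bcone_part 0 [::] _) => [N|]; last by rewrite mem_partitions.
    by rewrite sf_R_one /bpart big_nil.
  by apply: bcone_ext (bcone0 _) => N; rewrite sf_R_one.
move=> /andP[x0 s0].
apply: (@bcone_ext _ (fun N => \sum_(0 <= k < n.+1)
   x ^+ k *: (sf_R beta k N * sf_R (fps_prod beta s) (n - k) N))).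
  move=> N; rewrite fps_prod_cons sf_R_mul big_mkord; apply: eq_bigr => k _.
  by rewrite sf_R_scale scalerAl.
apply: bcone_sum => k; rewrite mem_index_iota ltnS => /andP[_ lekn].
by apply: bconeZ; [rewrite exprn_ge0|apply: bcone_mul => //; exact: IHs].
Qed.

Lemma bcone_nonneg_comb n f : bcone n f -> nonneg_comb (bpart beta) f.
Proof.
move=> [c c0 fE]; exists (partitions n), c; split => //; first exact: undup_uniq.
by apply/allP => la; rewrite mem_partitions => /andP[].
Qed.

(* The coefficients stay bounded by data_coef_le, so they have limits along U. *)
Lemma bcone_limit (U : set_system nat) (A : nat -> nat -> R) (a : nat -> R) (sigma : R) n :
  UltraFilter U -> (forall K, A K 0%N = 1) -> (forall K, 0 <= A K 1%N <= sigma) ->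
  (forall r, A ^~ r @ U --> a r) -> (forall K, bcone n (sf_R (A K) n)) ->
  bcone n (sf_R a n).
Proof.
move=> UU A0 A1 Aa AP; have UP : ProperFilter U by exact: ultra_proper.
have /choice[c cP] K : exists c : seq nat -> R, (forall la, 0 <= c la) /\
    forall N, sf_R (A K) n N = \sum_(la <- partitions n) c la *: bpart beta la N.
  by have [c ? ?] := AP K; exists c.
have c_le K la : la \in partitions n -> `|c K la| <= lfact R la * (sigma ^+ n / n`!%:R).
  move=> lan; have [c0 cE] := cP K; rewrite ger0_norm // mulrC -ler_pdivrMr ?lfact_gt0 //.
  have HL : expansion_data beta (A K) n (partitions n) (c K).
    split => // [mu|]; last exact: eval_bpart_comb.
    by rewrite mem_partitions => /andP[? /eqP].
  apply: (le_trans (data_coef_le BH (A0 K) HL lan)).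
  rewrite ler_wpM2r ?invr_ge0 //; have /andP[l u] := A1 K.
  by apply: lerXn2r; rewrite ?nnegrE // (le_trans l u).
have /choice[d dP] la : exists d : R, 0 <= d /\
    (la \in partitions n -> c K la @[K --> U] --> d).
  case: (boolP (la \in partitions n)) => lan; last by exists 0.
  have [d dP] := ultra_bounded_cvg UU (fun K => c_le K la lan).
  by exists d; split => //; apply: (cvgr_to_ge dP); near=> K; case: (cP K).
exists d => [la|N]; first by case: (dP la).
apply/mpolyP => m; rewrite raddf_sum /=.
have h1 : mcoeff m (sf_R (A K) n N) @[K --> U] --> mcoeff m (sf_R a n N).
  under eq_cvg do rewrite mcoeff_sf_R.
  by rewrite mcoeff_sf_R; apply: cvgMl_tmp; apply: cvg_prod_seq => i _; exact: Aa.
apply: (cvg_unique _ h1) => //=.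
under eq_cvg do rewrite (cP _).2 raddf_sum /=.
apply: cvg_sum_seq => la lan; under eq_cvg do rewrite mcoeffZ.
by rewrite mcoeffZ; apply: cvgMr_tmp; case: (dP la) => _; apply.
Unshelve. all: by end_near. Qed.

End Cone.

Section ReverseDirection.
Variables (R : realType) (beta : nat -> R) (B : R -> R).
Hypothesis BH : factor_series beta B.

Lemma B_ge1_le (y : R) : 0 <= y <= 2^-1 -> 1 <= B y <= expR (2 * y).
Proof.
move=> /andP[y0 y2]; have /andP[l u] : expR (y - 2 * y ^+ 2) <= B y <= expR (y + 2 * y ^+ 2).
  by apply: (factor_bound BH); rewrite ger0_norm.
apply/andP; split; [apply: le_trans l|apply: (le_trans u)]; rewrite -?[leLHS]expR0 ler_expR; nra.
Qed.

Lemma fps_prod0 s : fps_prod beta s 0 = 1.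
Proof.
elim: s => [|x s IHs]; first by rewrite fps_prod_nil.
by rewrite fps_prod_cons /fps_mul big_ord1 IHs /fps_scale (factor_coef0 BH) !mulr1.
Qed.

Lemma qprod_nseq_cvg (gamma t : R) : 0 <= gamma -> 0 <= t -> gamma * t <= 2^-1 ->
  qprod B (nseq K.+1 (gamma / K.+1%:R)) t @[K --> \oo] --> expR (gamma * t).
Proof.
move=> gamma0 t0 gt.
have lim (e : R) : expR (gamma * t + e * (gamma * t) ^+ 2 / K.+1%:R) @[K --> \oo]
    --> expR (gamma * t).
  apply: cvg_expR_comp; rewrite -[X in _ --> X]addr0; apply: cvgD; first exact: cvg_cst.
  rewrite -[X in _ --> X](mulr0 (e * (gamma * t) ^+ 2)); apply: cvgMl_tmp.
  exact: cvg_harmonic.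
apply: (squeeze_cvgr _ (lim (- 2)) (lim 2)); near=> K.
have K0 : K.+1%:R != 0 :> R by rewrite pnatr_eq0.
have bound : forall x, x \in nseq K.+1 (gamma / K.+1%:R) -> `|x * t| <= 2^-1.
  move=> x /nseqP[-> _]; rewrite ger0_norm ?mulr_ge0 ?divr_ge0 //; apply: le_trans gt.
  by rewrite mulrAC ler_piMr ?mulr_ge0 // invf_le1 ?ler1n.
have sumE (F : R -> R) : \sum_(x <- nseq K.+1 (gamma / K.+1%:R)) F x
    = F (gamma / K.+1%:R) * K.+1%:R by rewrite big_nseq iter_addr_0 mulr_natr.
have := qprod_bound BH bound; rewrite (sumE id) (sumE (fun x => x ^+ 2)).
have -> : t * (gamma / K.+1%:R * K.+1%:R) = gamma * t by field.
have -> : 2 * t ^+ 2 * ((gamma / K.+1%:R) ^+ 2 * K.+1%:R) = 2 * (gamma * t) ^+ 2 / K.+1%:R.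
  by field.
by rewrite !mulNr.
Unshelve. all: by end_near. Qed.

Lemma factor_prod_cvg (alpha : nat -> R) (t sigma : R) :
  (forall j, 0 <= alpha j) -> (forall K, series alpha K <= sigma) ->
  0 <= t -> sigma * t <= 2^-1 ->
  \prod_(0 <= j < K) B (alpha j * t) @[K --> \oo] --> infprod (fun j => B (alpha j * t)).
Proof.
move=> alpha0 asum t0 st.
have small j : 0 <= alpha j * t <= 2^-1.
  rewrite mulr_ge0 //=; apply: le_trans st; apply: ler_wpM2r => //.
  by apply: le_trans (asum j.+1); rewrite seriesSr lerDr sumr_ge0.
have prod0 K : 0 <= \prod_(0 <= j < K) B (alpha j * t).
  by apply: prodr_ge0 => j _; rewrite (le_trans ler01) //; case/andP: (B_ge1_le (small j)).
apply: nondecreasing_is_cvgn.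
  apply/nondecreasing_seqP => K; rewrite big_nat_recr //= ler_peMr //.
  by case/andP: (B_ge1_le (small K)).
exists (expR (2 * (sigma * t))) => _ [K _ <-].
apply: (@le_trans _ _ (\prod_(0 <= j < K) expR (2 * (alpha j * t)))).
  apply: ler_prod => j _; have /andP[l ->] := B_ge1_le (small j).
  by rewrite (le_trans ler01).
rewrite -expR_sum ler_expR -mulr_sumr ler_wpM2l // -mulr_suml ler_wpM2r //.
exact: asum.
Qed.

Theorem expansion_positive (a : nat -> R) (gamma : R) (alpha : nat -> R) :
  0 <= gamma -> (forall j, 0 <= alpha j) -> cvgn (series alpha) ->
  is_expansion a (fun t => expR (gamma * t) * infprod (fun j => B (alpha j * t))) ->
  forall n, nonneg_comb (bpart beta) (sf_R a n).
Proof.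
move=> gamma0 alpha0 calpha [r r0 aG] n.
pose S := limn (series alpha); pose sigma := gamma + S.
have alpha_nd : nondecreasing_seq (series alpha).
  by apply/nondecreasing_seqP => k; rewrite seriesSr lerDl.
have asum K : series alpha K <= S by exact: nondecreasing_cvgn_le.
have S0 : 0 <= S by apply: le_trans (asum 0%N); rewrite /series /= big_nil.
have sigma0 : 0 <= sigma by rewrite addr_ge0.
pose s K := nseq K.+1 (gamma / K.+1%:R) ++ [seq alpha j | j <- index_iota 0 K].
have s0 K : all (fun x => 0 <= x) (s K).
  rewrite all_cat all_nseq /= divr_ge0 //=; apply/allP => _ /mapP[j _ ->]; exact: alpha0.
have sE K : \sum_(x <- s K) x = gamma + series alpha K.
  have h : gamma / K.+1%:R *+ K.+1 = gamma.
    by rewrite -[LHS]mulr_natr divfK ?pnatr_eq0.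
  rewrite big_cat big_nseq iter_addr_0 h.
  by rewrite big_map.
have sle K : \sum_(x <- s K) x <= sigma by rewrite sE lerD2l.
have [M M0 aM] : exists2 M : R, 0 <= M & forall k, `|a k| <= M * (2 / r) ^+ k.
  have r2 : `|r / 2| < r by rewrite gtr0_norm ?divr_gt0 //; lra.
  have /cvg_series_bounded/pinfty_ex_gt0[M M0 aM] : cvgn (series (fun k => a k * (r / 2) ^+ k)).
    by apply/cvg_ex; eexists; exact: aG r2.
  exists M; first exact: ltW.
  move=> k; have := aM k Logic.I; rewrite /= normrM normrX (gtr0_norm (divr_gt0 r0 _)) //.
  by rewrite -ler_pdivlMr ?exprn_gt0 ?divr_gt0 // -exprVn invf_div.
pose rho := sigma + 2 / r.
have rho0 : 0 < rho by rewrite ltr_wpDl // divr_gt0.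
pose v j : R := (2 * rho)^-1 * j.+1%:R^-1.
have v0 j : 0 < v j by rewrite mulr_gt0 ?invr_gt0 ?mulr_gt0.
have vrho j : v j * rho <= 2^-1.
  have -> : v j * rho = 2^-1 * j.+1%:R^-1 by rewrite /v invfM [LHS]mulrAC divfK ?gt_eqF.
  by rewrite ler_piMr ?invr_ge0 // invf_le1 ?ler1n.
have vsigma j : v j * sigma <= 2^-1.
  by apply: le_trans (vrho j); rewrite ler_wpM2l ?(ltW (v0 j)) // lerDl divr_ge0 // ltW.
have vr j : `|v j| < r.
  have h : v j * (2 / r) <= 2^-1.
    by apply: le_trans (vrho j); rewrite ler_wpM2l ?(ltW (v0 j)) // lerDr.
  rewrite gtr0_norm //; move: h; rewrite mulrA ler_pdivrMr //; have := v0 j; lra.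
have cvgv : v @ \oo --> (0 : R).
  rewrite -[X in _ --> X](mulr0 (2 * rho)^-1); apply: cvgMl_tmp; exact: cvg_harmonic.
have [U [UU ooU]] := @ultraFilterLemma _ (\oo : set_system nat) _.
have UP : ProperFilter U by exact: ultra_proper.
have [q [qP qle qser]] := ultra_coef BH UU s0 sle.
have a_eq_q k : q k = a k.
  apply/eqP; rewrite -subr_eq0; apply/eqP; move: k.
  apply: (@power_series_eq0 R (fun r => q r - a r) (1 + M) rho v) => // [k||j].
  - apply: (le_trans (ler_normB _ _)); rewrite mulrDl mul1r; apply: lerD.
      apply: (le_trans (qle k)); apply: lerXn2r; rewrite ?nnegrE ?(ltW rho0) //.
      by rewrite lerDl divr_ge0 // ltW.
    apply: (le_trans (aM k)); apply: ler_wpM2l => //; apply: lerXn2r.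
    + by rewrite nnegrE divr_ge0 // ltW.
    + by rewrite nnegrE ltW.
    by rewrite lerDr.
  - exact: ltW.
  have gammav : gamma * v j <= 2^-1.
    rewrite mulrC; apply: le_trans (vsigma j); rewrite ler_wpM2l ?(ltW (v0 j)) //.
    by rewrite lerDl.
  have Sv : S * v j <= 2^-1.
    rewrite mulrC; apply: le_trans (vsigma j); rewrite ler_wpM2l ?(ltW (v0 j)) //.
    by rewrite lerDr.
  have QT : qprod B (s K) (v j) @[K --> \oo] -->
      expR (gamma * v j) * infprod (fun i => B (alpha i * v j)).
    have -> : (fun K => qprod B (s K) (v j)) = (fun K =>
        qprod B (nseq K.+1 (gamma / K.+1%:R)) (v j) * \prod_(0 <= i < K) B (alpha i * v j)).
      by apply: funext => K; rewrite /qprod big_cat big_map.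
    apply: cvgM; first exact: (qprod_nseq_cvg gamma0 (ltW (v0 j)) gammav).
    exact: (factor_prod_cvg alpha0 asum (ltW (v0 j)) Sv).
  have QU : qprod B (s K) (v j) @[K --> U] -->
    expR (gamma * v j) * infprod (fun i => B (alpha i * v j)) by move=> A /QT; exact: ooU.
  have qT := qser _ _ _ QU; rewrite gtr0_norm // in qT.
  have aT := aG _ (vr j).
  rewrite -(subrr (expR (gamma * v j) * infprod (fun i => B (alpha i * v j)))).
  have -> : series (fun r => (q r - a r) * v j ^+ r)
      = series (fun r => q r * v j ^+ r) - series (fun r => a r * v j ^+ r).
    rewrite -seriesN -seriesD; congr series; apply: funext => k /=.
    by rewrite mulrBl.
  by apply: cvgB => //; exact: qT.
apply: (@bcone_nonneg_comb _ _ n).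
apply: (@bcone_limit _ _ _ BH U (fun K => fps_prod beta (s K)) a sigma) => //.
- by move=> K; exact: fps_prod0.
- move=> K; rewrite (fps_prod_ge0 BH _ (s0 K)) /=; apply: le_trans (sle K).
  by rewrite -[leRHS]expr1; exact: (fps_prod_le BH _ (s0 K)).
- by move=> k; rewrite -a_eq_q.
by move=> K; exact: (bcone_fps_prod BH).
Qed.
End ReverseDirection.

Section Factors.
Variable R : realType.

Lemma expR_le_1Dx (y : R) : `|y| <= 2^-1 -> expR (y - 2 * y ^+ 2) <= 1 + y.
Proof.
move=> /ler_normlP[y1 y2].
have -> : y - 2 * y ^+ 2 = - (2 * y ^+ 2 - y) by ring.
rewrite expRN -[X in X <= _]mul1r ler_pdivrMr ?expR_gt0 //.
apply: (@le_trans _ _ ((1 + y) * (1 + (2 * y ^+ 2 - y)))); last first.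
  by apply: ler_wpM2l; [lra|exact: expR_ge1Dx].
have -> : (1 + y) * (1 + (2 * y ^+ 2 - y)) = 1 + y ^+ 2 * (1 + 2 * y) by ring.
by rewrite lerDl mulr_ge0 ?sqr_ge0 //; lra.
Qed.

Lemma factor_series_e : factor_series (@e_coef R) (fun y => 1 + y).
Proof.
split => //.
- by move=> k; rewrite /e_coef ler0n lern1 leq_b1.
- move=> y _; apply: cvg_near_cst; exists 2%N => // -[|[|n]] // _.
  rewrite /series /= !big_nat_recl //= big1 ?addr0; last first.
    by move=> i _; rewrite /e_coef mul0r.
  by rewrite /e_coef !mul1r expr0 expr1.
- move=> y y2; rewrite expR_le_1Dx //=; apply: le_trans (expR_ge1Dx _) _.
  by rewrite ler_expR lerDl mulr_ge0 ?sqr_ge0.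
by move=> y _; apply: cvgD; [exact: cvg_cst|exact: cvg_id].
Qed.

Lemma factor_series_h : factor_series (@h_coef R) (fun y => 1 / (1 - y)).
Proof.
have pos (y : R) : `|y| <= 2^-1 -> 0 < 1 - y by move=> /ler_normlP[y1 y2]; lra.
split => //.
- by move=> k; rewrite /h_coef ler01 lexx.
- move=> y y2; apply: cvg_geometric_series; apply: le_lt_trans y2 _.
  by rewrite invf_lt1 // ltr1n.
- move=> y y2; have p := pos y y2; rewrite div1r; apply/andP; split.
    rewrite -[y - _]opprK expRN lef_pV2 ?posrE ?expR_gt0 //.
    apply: le_trans (expR_ge1Dx _); have := sqr_ge0 y; lra.
  rewrite -[y + _]opprK expRN lef_pV2 ?posrE ?expR_gt0 //.
  by have := @expR_le_1Dx (- y); rewrite normrN sqrrN -opprD => /(_ y2).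
move=> y /pos p; apply: cvgM; first exact: cvg_cst.
apply: cvgV; first by rewrite gt_eqF.
by apply: cvgB; [exact: cvg_cst|exact: cvg_id].
Qed.

Lemma nonneg_comb_ext (b b' : seq nat -> symfun R) (f : symfun R) :
  (forall la N, b la N = b' la N) -> nonneg_comb b f <-> nonneg_comb b' f.
Proof.
move=> bb'; split=> -[s [c [us ps c0 fE]]]; exists s, c; split => // N; rewrite fE;
  by apply: eq_bigr => la _; rewrite bb'.
Qed.

Lemma e_positiveE (f : symfun R) : e_positive f <-> nonneg_comb (bpart (@e_coef R)) f.
Proof.
by apply: nonneg_comb_ext => la N; apply: eq_bigr => k _; rewrite sf_e_R.
Qed.

Lemma h_positiveE (f : symfun R) : h_positive f <-> nonneg_comb (bpart (@h_coef R)) f.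
Proof.
by apply: nonneg_comb_ext => la N; apply: eq_bigr => k _; rewrite sf_h_R.
Qed.

End Factors.

Local Close Scope classical_set_scope.

Theorem theorem2p11 (R : realType) (a : nat -> R) (a0 : a 0%N = 1) :
  ((forall n, e_positive (sf_R a n)) <->
   (exists (gamma : R) (alpha : nat -> R),
      [/\ 0 <= gamma,
          (forall j, 0 <= alpha j),
          cvgn (series alpha) &
          is_expansion a
            (fun t => expR (gamma * t) * infprod (fun j => 1 + alpha j * t))])) /\
  ((forall n, h_positive (sf_R a n)) <->
   (exists (gamma : R) (beta : nat -> R),
      [/\ 0 <= gamma,
          (forall j, 0 <= beta j),
          cvgn (series beta) &
          is_expansion a
            (fun t => expR (gamma * t) * infprod (fun j => 1 / (1 - beta j * t)))])).
Proof.
split; split.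
- move=> pos; apply: (positive_expansion (factor_series_e R) a0) => n.
  exact/e_positiveE.
- move=> [gamma [alpha [gamma0 alpha0 calpha aG]]] n; apply/e_positiveE.
  exact: (expansion_positive (factor_series_e R) gamma0 alpha0 calpha aG).
- move=> pos; apply: (positive_expansion (factor_series_h R) a0) => n.
  exact/h_positiveE.
move=> [gamma [alpha [gamma0 alpha0 calpha aG]]] n; apply/h_positiveE.
exact: (expansion_positive (factor_series_h R) gamma0 alpha0 calpha aG).
Qed.
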